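(* Let $M$ be a smooth manifold, let $Q=(x\mapsto Q_x)$ be a smooth section of positive definite quadratic forms on $TM$, let $U:M\to\mathbb R$ be a nonnegative smooth function, and consider the Lagrangian $L(x,v)=Q_x(v)-U(x)$ on $TM$. Let $p\in M$ be a point with $U(p)=0$. If there is a locally Lipschitz continuous vector field, defined on some neighbourhood of $p$ in $M$, which is weakly logarithmic for $U$ there and non null at $p$, then $(p,\mathbf 0)$ is a Lyapunov unstable equilibrium point of the Euler-Lagrange dynamics of $L$.
   Context: A vector field $V$ defined on an open subset $A\subset M$ is weakly logarithmic for $U$ in $A$ if there is a function $P:A\to\mathbb R$, bounded on compact subsets of $A$, such that $V(U)=P\,U$ on $A$. The dynamics of $L$ on $TM$ is given by the Euler-Lagrange equations $\frac{d}{dt}\frac{\partial L}{\partial v_i}(x(t),\dot x(t))-\frac{\partial L}{\partial x_i}(x(t),\dot x(t))=0$; if $p$ is a critical point of $U$ then $(p,\mathbf 0)$ is an equilibrium. (Every zero of a nonnegative smooth $U$ is a critical point.) An equilibrium $(p,\mathbf 0)$ is Lyapunov stable if for every neighbourhood $W$ of it in $TM$ there is a smaller neighbourhood $W'\subset W$ of it such that every orbit starting in $W'$ does not leave $W$ in future time; it is Lyapunov unstable if it is not Lyapunov stable. *)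

(* Defs.v *)
From HB Require Import structures.
From mathcomp Require Import all_boot all_order all_algebra.
From mathcomp Require Import all_classical all_reals all_analysis.

Set Implicit Arguments.
Unset Strict Implicit.
Unset Printing Implicit Defensive.

Import Order.TTheory GRing.Theory Num.Theory.
Import numFieldNormedType.Exports.

Local Open Scope classical_set_scope.
Local Open Scope ring_scope.

(* [D] is meant to be open: differentiability at a point of [D] is taken in the
   ambient space. *)
Fixpoint Ck (R : realType) (E F : normedModType R) (k : nat) (D : set E)
    (f : E -> F) : Prop :=
  if k is k'.+1 then
    (forall x, D x -> differentiable f x) /\
    (forall v : E, Ck k' D (fun x => 'D_v f x))
  else forall x, D x -> {for x, continuous f}.

Definition smooth_on (R : realType) (E F : normedModType R) (D : set E)
    (f : E -> F) : Prop :=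
  forall k, Ck k D f.

(* Partial homeomorphisms to R^n, encoded by total maps of which only the
   restrictions to [cdom] and [cimg] matter. *)
Record chart (R : realType) (n : nat) (M : topologicalType) := Chart {
  cdom : set M;
  cimg : set 'rV[R]_n;
  cmap : M -> 'rV[R]_n;
  cinv : 'rV[R]_n -> M;
  cdom_open : open cdom;
  cimg_open : open cimg;
  cmap_img : forall x, cdom x -> cimg (cmap x);
  cinv_dom : forall y, cimg y -> cdom (cinv y);
  cmapK : forall x, cdom x -> cinv (cmap x) = x;
  cinvK : forall y, cimg y -> cmap (cinv y) = y;
  cmap_cont : forall x, cdom x -> {for x, continuous cmap};
  cinv_cont : forall y, cimg y -> {for y, continuous cinv}
}.

(* [atlas] need not be maximal; [chart_at] picks a chart of [atlas] around each
   point and only serves to represent tangent vectors (see [tangent]). *)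
Record smooth_manifold (R : realType) (n : nat) := SmoothManifold {
  carrier :> topologicalType;
  manifold_hausdorff : hausdorff_space carrier;
  manifold_second_countable : @second_countable carrier;
  atlas : set (chart R n carrier);
  chart_at : carrier -> chart R n carrier;
  chart_at_atlas : forall x, atlas (chart_at x);
  chart_at_dom : forall x, cdom (chart_at x) x;
  atlas_compat : forall c d, atlas c -> atlas d ->
    smooth_on [set y | cimg c y /\ cdom d (cinv c y)] (cmap d \o cinv c)
}.

Section Manifold.
Context {R : realType} {n : nat} {M : smooth_manifold R n}.

Definition smooth_function (f : M -> R) : Prop :=
  forall c, atlas c -> smooth_on (cimg c) (f \o cinv c).

(* A tangent vector at [x] is represented by its components in the chart
   [chart_at M x]; its components in another chart [c] are given by the
   Jacobian of the change of charts, see [tcoord] and [tparam]. *)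
Definition tangent (x : M) : Type := 'rV[R]_n.


Record tangent_bundle := TPoint { tbase : M; tvec : tangent tbase }.

Definition tcoord (c : chart R n M) (x : M) (v : tangent x) : 'rV[R]_n :=
  'd (cmap c \o cinv (chart_at x)) (cmap (chart_at x) x) v.

(* The local parametrization of TM attached to [c]: the vector at [cinv c y]
   whose components in the chart [c] are [u]. *)
Definition tparam (c : chart R n M) (y u : 'rV[R]_n) : tangent_bundle :=
  @TPoint (cinv c y) ('d (cmap (chart_at (cinv c y)) \o cinv c) y u).

(* The topology of TM for which the parametrizations
   [tparam c : cimg c x R^n -> TM] are homeomorphisms onto open sets. *)
Definition tb_open (W : set tangent_bundle) : Prop :=
  forall c, atlas c ->
    open [set z : 'rV[R]_n * 'rV[R]_n | cimg c z.1 /\ W (tparam c z.1 z.2)].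

Lemma tb_openT : tb_open setT.
Proof.
move=> c _.
have -> : [set z : 'rV[R]_n * 'rV[R]_n | cimg c z.1 /\ setT (tparam c z.1 z.2)]
    = fst @^-1` cimg c by apply/seteqP; split => z //= -[].
by apply: open_comp => [z _|]; [exact: cvg_fst|exact: cimg_open].
Qed.

Lemma tb_openI : setI_closed tb_open.
Proof.
move=> A B oA oB c ac; have := openI (oA c ac) (oB c ac).
by congr open; apply/seteqP; split => z /=; [move=> [[? ?] [? ?]]|move=> [? []]].
Qed.

Lemma tb_open_bigU (I : Type) (f : I -> set tangent_bundle) :
  (forall i, tb_open (f i)) -> tb_open (\bigcup_i f i).
Proof.
move=> fo c ac; have := bigcup_open (fun i (_ : setT i) => fo i c ac).
congr open; apply/seteqP; split => z /=.
  by move=> [i _ [? ?]]; split => //; exists i.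
by move=> [? [i _ ?]]; exists i.
Qed.

HB.instance Definition _ := gen_eqMixin tangent_bundle.
HB.instance Definition _ := gen_choiceMixin tangent_bundle.
HB.instance Definition _ :=
  isOpenTopological.Build tangent_bundle tb_openT tb_openI tb_open_bigU.

(* Fibrewise quadratic forms on TM whose coefficients [g i j] in every chart
   are smooth functions. *)
Definition smooth_quadratic_section (Q : forall x : M, tangent x -> R) : Prop :=
  forall c, atlas c -> exists g : 'I_n -> 'I_n -> 'rV[R]_n -> R,
    [/\ forall i j, smooth_on (cimg c) (g i j),
        forall i j y, cimg c y -> g i j y = g j i y &
        forall x (v : tangent x), cdom c x ->
          Q x v = \sum_i \sum_j
            g i j (cmap c x) * tcoord c v 0 i * tcoord c v 0 j].

Definition positive_definite (Q : forall x : M, tangent x -> R) : Prop :=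
  forall x (v : tangent x), v != 0 -> 0 < Q x v.

(* Vector fields on an open set [A] are total sections of TM of which only the
   values on [A] matter. *)
Definition locally_lipschitz_field (A : set M) (V : forall x : M, tangent x) :
    Prop :=
  forall c, atlas c ->
    [locally [lipschitz (tcoord c (V (cinv c y)))
             | y in [set y | cimg c y /\ A (cinv c y)]]].

Definition lie_derivative (V : forall x : M, tangent x) (f : M -> R) (x : M) :
    R :=
  'd (f \o cinv (chart_at x)) (cmap (chart_at x) x) (V x).

Definition weakly_logarithmic (U : M -> R) (A : set M)
    (V : forall x : M, tangent x) : Prop :=
  exists P : M -> R,
    (forall K, compact K -> K `<=` A -> [bounded P x | x in K]) /\
    (forall x, A x -> lie_derivative V U x = P x * U x).

Definition velocity (g : R -> M) (t : R) : tangent (g t) :=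
  derive1 (cmap (chart_at (g t)) \o g) t.

Definition tangent_lift (g : R -> M) (t : R) : tangent_bundle :=
  TPoint (velocity g t).

Definition lagrangian (Q : forall x : M, tangent x -> R) (U : M -> R)
    (w : tangent_bundle) : R :=
  Q (tbase w) (tvec w) - U (tbase w).

Definition euler_lagrange_at (L : tangent_bundle -> R) (c : chart R n M)
    (g : R -> M) (t : R) : Prop :=
  let q := cmap c \o g in
  forall i : 'I_n,
    is_derive t (1 : R)
      (fun s => 'D_(delta_mx 0 i) (fun u => L (tparam c (q s) u)) (derive1 q s))
      ('D_(delta_mx 0 i) (fun y => L (tparam c y (derive1 q t))) (q t)).

Definition motion (L : tangent_bundle -> R) (J : set R) (g : R -> M) : Prop :=
  [/\ open J, is_interval J, forall t, J t -> {for t, continuous g} &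
      forall c, atlas c ->
        Ck 2 (J `&` g @^-1` cdom c) (cmap c \o g) /\
        forall t, J t -> cdom c (g t) -> euler_lagrange_at L c g t].

Definition equilibrium (L : tangent_bundle -> R) (w : tangent_bundle) : Prop :=
  exists2 g, motion L setT g & forall t, tangent_lift g t = w.

(* Motions on arbitrary open intervals around the initial time 0 are allowed:
   no completeness of the dynamics is assumed. *)
Definition lyapunov_stable (L : tangent_bundle -> R) (w : tangent_bundle) :
    Prop :=
  forall W, nbhs w W -> exists W', [/\ W' `<=` W, nbhs w W' &
    forall (J : set R) (g : R -> M), motion L J g -> J 0 ->
      W' (tangent_lift g 0) ->
      forall t, J t -> 0 <= t -> W (tangent_lift g t)].

Definition lyapunov_unstable_equilibrium (L : tangent_bundle -> R)
    (w : tangent_bundle) : Prop :=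
  equilibrium L w /\ ~ lyapunov_stable L w.

End Manifold.

Arguments tangent_bundle {R n} M.

(* Main.v *)
(* Start at p with velocity eps V(p). The energy, hence the square of the speed,
   is O(eps^2) along the motion because U >= 0. The momentum along V starts at
   about eps, and its rate of change consists of terms quadratic in the velocity
   and of -V(U) = -P U, so it is O(eps^2) as well. As long as the motion stays
   near p, the momentum along V thus remains of order eps during a time of order
   1 / eps, in which the motion covers a distance bounded below independently of
   eps. *)

Require Import Defs.
From mathcomp Require Import all_boot all_order all_algebra.
From mathcomp Require Import all_classical all_reals all_analysis.
From mathcomp Require Import ring lra.

Set Implicit Arguments.
Unset Strict Implicit.
Unset Printing Implicit Defensive.

Import Order.TTheory GRing.Theory Num.Theory.
Import numFieldNormedType.Exports.

Local Open Scope classical_set_scope.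
Local Open Scope ring_scope.

(** * Calculus *)

(** Stability is refuted only by an actual motion, and the dynamics need not be complete, so the
    motion has to be built. Clamping to a box around [(y0, 0)] in one chart makes the field globally
    Lipschitz, and a global Picard theorem applies. The clamped curve is a genuine motion only
    inside the box. The proof supposes that no motion with the chosen initial velocity gets [rho]
    away from [p]: then the position stays in the box by assumption and the velocity by conservation
    of energy, so the curve is genuine long enough for the momentum estimate to give a
    contradiction. Metric and vector field vary with the position. Distance is therefore measured
    through the covector of [V] frozen at [p], and [rho] is taken so small that freezing costs only
    part of the momentum. Speed is of order eps and time of order 1 / eps, so [rho] does not depend
    on eps. A motion has to satisfy the equations in every chart, whence the covariance argument. *)

Section RowVectors.
Context {R : realType}.

Lemma normr_coord m n (v : 'M[R]_(m, n)) i j : `|v i j| <= `|v|.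
Proof.
rewrite [leRHS]/Num.norm /= mx_normrE.
exact: (le_bigmax _ (fun ij : 'I_m * 'I_n => `|v ij.1 ij.2|) (i, j)).
Qed.

Lemma normr_rV_le n (v : 'rV[R]_n) e :
  0 <= e -> (forall i, `|v 0 i| <= e) -> `|v| <= e.
Proof.
move=> e0 ve; rewrite [leLHS]/Num.norm /= mx_normrE.
by apply: bigmax_le => // -[i j] _; rewrite ord1.
Qed.

Lemma is_derive_mx (V : normedModType R) m n (M : V -> 'M[R]_(m, n)) t v
    (dM : 'M[R]_(m, n)) :
  (forall i j, is_derive t v (fun x => M x i j) (dM i j)) -> is_derive t v M dM.
Proof.
move=> H; have dMt : derivable M t v by apply/derivable_mxP => i j; have [] := H i j.
apply: DeriveDef => //; rewrite derive_mx//; apply/matrixP => i j.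
by rewrite mxE; have [_ ->] := H i j.
Qed.

Lemma is_derive_coord (V : normedModType R) m n (M : V -> 'M[R]_(m, n)) t v
    (dM : 'M[R]_(m, n)) i j :
  is_derive t v M dM -> is_derive t v (fun x => M x i j) (dM i j).
Proof.
move=> [dMt <-]; apply: DeriveDef; first by move/derivable_mxP : dMt; exact.
by rewrite derive_mx// mxE.
Qed.

Lemma is_derive_bigsum (V W : normedModType R) (I : Type) (r : seq I)
    (h : I -> V -> W) (dh : I -> W) x v :
  (forall i, is_derive x v (h i) (dh i)) ->
  is_derive x v (fun y => \sum_(i <- r) h i y) (\sum_(i <- r) dh i).
Proof.
move=> H; elim: r => [|i r IH].
  by rewrite big_nil; under eq_fun do rewrite big_nil; exact: is_derive_cst.
by rewrite big_cons; under eq_fun do rewrite big_cons; exact: is_deriveD.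
Qed.

Lemma rV_sum_delta n (v : 'rV[R]_n) : v = \sum_i v 0 i *: delta_mx 0 i.
Proof. exact: row_sum_delta. Qed.

Lemma diff_sum_delta n (W : normedModType R) (f : 'rV[R]_n -> W) x v :
  differentiable f x ->
  'D_v f x = \sum_i v 0 i *: 'D_(delta_mx 0 i) f x.
Proof.
move=> df; rewrite deriveE// [in LHS](rV_sum_delta v) linear_sum/=.
by apply: eq_bigr => i _; rewrite linearZ/= deriveE.
Qed.

Lemma is_derive_curve (E F : normedModType R) (f : E -> F) (q : R -> E) (t : R) (dq : E) :
  is_derive t 1 q dq -> differentiable f (q t) ->
  is_derive t 1 (f \o q) ('D_dq f (q t)).
Proof.
move=> [dq1 dqE] df; have dq' : differentiable q t by apply/derivable1_diffP.
have dfq : differentiable (f \o q) t by exact: differentiable_comp.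
apply: DeriveDef; first exact/derivable1_diffP.
by rewrite deriveE// diff_comp//= -(deriveE _ dq') dqE deriveE.
Qed.

Lemma is_derive_comp (E F G : normedModType R) (f : F -> G) (q : E -> F) x v :
  differentiable q x -> differentiable f (q x) ->
  is_derive x v (f \o q) ('D_('D_v q x) f (q x)).
Proof.
move=> dq df; have dfq : differentiable (f \o q) x by exact: differentiable_comp.
apply: DeriveDef; first exact: diff_derivable.
by rewrite deriveE// diff_comp//= -(deriveE _ dq) [RHS]deriveE.
Qed.

Lemma diff_comp_derive (E F G : normedModType R) (f : F -> G) (q : E -> F) x v :
  differentiable q x -> differentiable f (q x) ->
  'd f (q x) ('d q x v) = 'D_v (f \o q) x.
Proof.
move=> dq df; apply: esym; apply: (etrans (@derive_val _ _ _ _ _ _ _ (is_derive_comp v dq df))).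
by apply: (etrans (deriveE _ df)); congr ('d f (q x) _); exact: deriveE.
Qed.

Lemma is_derive_continuous (F : normedModType R) (f : R -> F) (t : R) (df : F) :
  is_derive t 1 f df -> {for t, continuous f}.
Proof.
by move=> [d _]; apply: differentiable_continuous; apply/derivable1_diffP.
Qed.

End RowVectors.

(** * Smooth maps on open sets and the symmetry of second derivatives *)

Section Smooth.
Context {R : realType}.
Implicit Types E F : normedModType R.

Lemma smooth_on_diff E F (D : set E) (f : E -> F) x :
  smooth_on D f -> D x -> differentiable f x.
Proof. by move=> /(_ 1) [] + _; exact. Qed.

Lemma smooth_on_derive E F (D : set E) (f : E -> F) v :
  smooth_on D f -> smooth_on D ('D_v f).
Proof. by move=> sf k; have [_ +] := sf k.+1; exact. Qed.

Lemma smooth_on_cont E F (D : set E) (f : E -> F) x :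
  smooth_on D f -> D x -> {for x, continuous f}.
Proof. by move=> /(_ 0); exact. Qed.

Lemma near_eq0_differentiable E F (h : E -> F) x :
  (\forall y \near x, h y = 0) -> differentiable h x.
Proof.
move=> h0; have h0x := nbhs_singleton h0.
have oh : h \o shift x = cst (h x) + (\0 : E -> F) +o_ 0 id.
  apply/eqaddoP => e e0; rewrite [\forall x \near _, _](near_shift x) sub0r /=.
  near=> y; rewrite !fctE/= subrK h0x addr0 (near h0)// subrr normr0.
  by rewrite mulr_ge0// ltW.
have dh : 'd h x = (\0 : E -> F) :> (E -> F).
  by apply: diff_unique => //; exact: cst_continuous.
by apply/diff_locallyP; rewrite dh; split => //; exact: cst_continuous.
Unshelve. all: by end_near. Qed.

Lemma near_eq_differentiable E F (f g : E -> F) x :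
  (\forall y \near x, f y = g y) -> differentiable f x -> differentiable g x.
Proof.
move=> fg df; have -> : g = f + (g - f) by rewrite addrC subrK.
apply: differentiableD; [exact: df|apply: near_eq0_differentiable].
by apply: filterS fg => y; rewrite !fctE => ->; rewrite subrr.
Qed.

Lemma is_derive_line E F (f : E -> F) a v (s : R) :
  differentiable f (a + s *: v) ->
  is_derive s 1 (fun r => f (a + r *: v)) ('D_v f (a + s *: v)).
Proof.
move=> df; apply: (@is_derive_curve _ _ _ f (fun r => a + r *: v)) => //.
have : is_derive s 1 (cst a + *:%R^~ v) (0 + v); last by rewrite add0r.
apply: is_deriveD; apply: DeriveDef; first exact/derivable1_diffP.
by rewrite deriveE// diff_val scale1r.
Qed.

Lemma MVT_line E (f : E -> R) a v h : 0 < h ->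
  (forall s, 0 <= s <= h -> differentiable f (a + s *: v)) ->
  exists2 s, 0 <= s <= h & f (a + h *: v) - f a = h * 'D_v f (a + s *: v).
Proof.
move=> h0 df.
have [||s] := @MVT R (fun r => f (a + r *: v)) (fun r => 'D_v f (a + r *: v)) 0 h h0.
- by move=> s; rewrite in_itv/= => /andP[s0 sh]; apply/is_derive_line/df; rewrite !ltW.
- apply: derivable_within_continuous => s; rewrite in_itv/= => sh.
  by have [] := is_derive_line (df s sh).
rewrite in_itv/= => /andP[s0 sh]; rewrite scale0r addr0 subr0 => ->.
by exists s; [rewrite !ltW|rewrite mulrC].
Qed.

(* Both mixed derivatives arise as limits of this second difference, which is
   symmetric in [v] and [w]. *)
Lemma second_difference E (f : E -> R) x v w e h : 0 < h ->
  h * (`|v| + `|w|) < e ->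
  (forall y, `|y - x| < e -> differentiable f y /\ differentiable ('D_v f) y) ->
  exists2 y, `|y - x| < e &
    f (x + h *: v + h *: w) - f (x + h *: v) - (f (x + h *: w) - f x) =
    h * (h * 'D_w ('D_v f) y).
Proof.
move=> h0 he df.
have inb s r : 0 <= s <= h -> 0 <= r <= h -> `|x + s *: v + r *: w - x| < e.
  move=> /andP[s0 sh] /andP[r0 rh]; apply: le_lt_trans he.
  rewrite -[x + _ + _]addrA [_ - x]addrC addKr (le_trans (ler_normD _ _))// !normrZ.
  by rewrite !ger0_norm// mulrDr lerD// ler_wpM2r.
have hh : 0 <= h <= h by rewrite lexx ltW.
have h00 : 0 <= (0 : R) <= h by rewrite lexx ltW.
(* The mean value theorem is applied twice: along [v] to the increment [G] of [f] in the direction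
   [w], then along [w] to ['D_v f]. *)
pose G := (fun r => f (x + h *: w + r *: v)) - (fun r => f (x + r *: v)).
have dG (s : R) : 0 <= s <= h ->
    is_derive s 1 G ('D_v f (x + h *: w + s *: v) - 'D_v f (x + s *: v)).
  move=> sh; apply: is_deriveB; apply: is_derive_line.
    by rewrite addrAC; have [] := df _ (inb _ _ sh hh).
  by have [] := df _ (inb _ _ sh h00); rewrite scale0r addr0.
have [||s] := @MVT R G (fun s => 'D_v f (x + h *: w + s *: v) - 'D_v f (x + s *: v)) 0 h h0.
- by move=> s; rewrite in_itv/= => /andP[s0 sh]; apply: dG; rewrite !ltW.
- apply: derivable_within_continuous => s; rewrite in_itv/= => sh.
  by have [] := dG s sh.
rewrite in_itv/= subr0 => /andP[s0 sh].
have {s0}sh : 0 <= s <= h by rewrite !ltW.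
have [r rh|r rh Er] := @MVT_line E ('D_v f) (x + s *: v) w h h0.
  by have [] := df _ (inb _ _ sh rh).
rewrite [x + _ + s *: v]addrAC Er /G !fctE !scale0r !addr0 => EG.
by exists (x + s *: v + r *: w); [exact: inb|rewrite [x + _ + h *: w]addrAC EG mulrC].
Qed.

(** Schwarz's theorem: the second difference divided by [h ^+ 2] is a mixed derivative of either
    order at points near [x], and both are continuous at [x]. *)
Lemma mixed_derive_scalar E (f : E -> R) x v w :
  (\forall y \near x, [/\ differentiable f y, differentiable ('D_v f) y &
     differentiable ('D_w f) y]) ->
  {for x, continuous ('D_w ('D_v f))} -> {for x, continuous ('D_v ('D_w f))} ->
  'D_w ('D_v f) x = 'D_v ('D_w f) x.
Proof.
move=> nf c1 c2; apply/eqP; rewrite -subr_eq0 -normr_le0; apply/ler_addgt0Pl => e e0.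
rewrite addr0.
have e20 : 0 < e / 2 by rewrite divr_gt0.
have nn : \forall y \near x, [/\ differentiable f y, differentiable ('D_v f) y,
   differentiable ('D_w f) y, `|'D_w ('D_v f) x - 'D_w ('D_v f) y| < e / 2 &
    `|'D_v ('D_w f) x - 'D_v ('D_w f) y| < e / 2].
  have /cvgrPdist_lt/(_ _ e20) {}c1 := c1.
  have /cvgrPdist_lt/(_ _ e20) {}c2 := c2.
  apply: filterS (filterI nf (filterI c1 c2)) => y /= [[h1 h2 h3] [h4 h5]].
  split; [exact: h1|exact: h2|exact: h3|exact: h4|exact: h5].
move: nn => /nbhs_normP[d/= d0 nd].
(* This [h] keeps both steps within [d] of [x]; the summand 1 allows [v = w = 0]. *)
pose h := d / 2 / (`|v| + `|w| + 1).
have hp : 0 < `|v| + `|w| + 1 by rewrite ltr_wpDl// addr_ge0.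
have h0 : 0 < h by rewrite !divr_gt0.
have hd : h * (`|v| + `|w|) < d.
  rewrite /h -mulrA (@le_lt_trans _ _ (d / 2))//; last first.
    by rewrite ltr_pdivrMr// ltr_pMr// ltr1n.
  rewrite ler_piMr//; first by rewrite divr_ge0// ltW.
  by rewrite mulrC ler_pdivrMr// mul1r lerDl.
have nd' y : `|y - x| < d -> [/\ differentiable f y, differentiable ('D_v f) y,
   differentiable ('D_w f) y, `|'D_w ('D_v f) x - 'D_w ('D_v f) y| < e / 2 &
    `|'D_v ('D_w f) x - 'D_v ('D_w f) y| < e / 2].
  by move=> yd; apply: nd; rewrite /= distrC.
have [y yd Ey] := second_difference h0 hd
  (fun y yd => let: And5 a b _ _ _ := nd' y yd in conj a b).
rewrite addrC in hd.
have [z zd Ez] := second_difference h0 hd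
  (fun y yd => let: And5 a _ b _ _ := nd' y yd in conj a b).
have EE : 'D_w ('D_v f) y = 'D_v ('D_w f) z.
  have hn : h != 0 by rewrite gt_eqF.
  rewrite [x + _ + h *: v]addrAC in Ez; move: Ey Ez.
  move: ('D_w ('D_v f) y) ('D_v ('D_w f) z) => A B.
  move: (f _) (f _) (f _) (f _) => a1 a2 a3 a4 EA EB.
  apply: (mulfI hn); apply: (mulfI hn).
  by rewrite /= -EA -EB; ring.
have [_ _ _ yd1 _] := nd' y yd; have [_ _ _ _ zd1] := nd' z zd.
rewrite -EE in zd1; move: yd1 zd1.
move: ('D_w ('D_v f) x) ('D_v ('D_w f) x) ('D_w ('D_v f) y) => a b c ac bc.
apply: (le_trans (ler_distD c _ _)).
rewrite [leRHS]splitr; apply: lerD; first exact: ltW.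
by rewrite distrC; exact: ltW.
Qed.

Lemma differentiable_mx_coord E m n (f : E -> 'M[R]_(m, n)) x i j :
  differentiable f x -> differentiable (fun y => f y i j) x.
Proof.
move=> df; apply: (@differentiable_comp _ _ _ _ f (fun N : 'M[R]_(m, n) => N i j)) => //.
exact: differentiable_coord.
Qed.

Lemma derive_mx_coord E m n (f : E -> 'M[R]_(m, n)) x v i j :
  differentiable f x -> 'D_v (fun y => f y i j) x = 'D_v f x i j.
Proof. by move=> df; rewrite derive_mx ?mxE//; exact: diff_derivable. Qed.

(** Schwarz's theorem entry by entry. Derivatives of an entry agree with entries of the derivatives
    on [D] only, so each fact is transferred through a neighbourhood inside [D]. *)
Lemma mixed_derive E m n (D : set E) (f : E -> 'M[R]_(m, n)) x v w : open D ->
  smooth_on D f -> D x -> 'D_w ('D_v f) x = 'D_v ('D_w f) x.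
Proof.
move=> oD sf Dx; apply/matrixP => i j.
have nD : \forall y \near x, D y by exact: open_nbhs_nbhs.
have dE u y : D y -> 'D_u (fun y => f y i j) y = 'D_u f y i j.
  by move=> Dy; apply: derive_mx_coord; exact: smooth_on_diff Dy.
have ddE u u' y : D y -> 'D_u' ('D_u (fun y => f y i j)) y = 'D_u' ('D_u f) y i j.
  move=> Dy; rewrite -derive_mx_coord; last exact/(smooth_on_diff _ Dy)/smooth_on_derive.
  by apply: near_eq_derive; apply: filterS (open_nbhs_nbhs (conj oD Dy)) => z; exact: dE.
have cc u u' : {for x, continuous ('D_u' ('D_u (fun y => f y i j)))}.
  have c2 : {for x, continuous (fun y => 'D_u' ('D_u f) y i j)}.
    apply: (@continuous_comp _ _ _ ('D_u' ('D_u f)) (fun M : 'M[R]_(m, n) => M i j)).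
      exact/(smooth_on_cont _ Dx)/smooth_on_derive/smooth_on_derive.
    exact: coord_continuous.
  rewrite /prop_for/continuous_at ddE//; apply: cvg_trans c2; apply: near_eq_cvg.
  by apply: filterS nD => y Dy; rewrite ddE.
apply: (etrans (esym (ddE v w x Dx))); apply: (etrans _ (ddE w v x Dx)).
apply: mixed_derive_scalar.
- apply: filterS nD => y Dy.
  have dd u : differentiable ('D_u (fun y : E => f y i j)) y.
    apply: (@near_eq_differentiable _ _ (fun y => 'D_u f y i j)).
      by apply: filterS (open_nbhs_nbhs (conj oD Dy)) => z Dz; rewrite dE.
    exact/differentiable_mx_coord/(smooth_on_diff _ Dy)/smooth_on_derive.
  by split => //; exact/differentiable_mx_coord/(smooth_on_diff sf Dy).
- exact: cc.
- exact: cc.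
Qed.

(** [Ck] asks for derivatives along every [r : R]; each is [r] times the derivative along 1, so the
    two usual derivatives of a curve suffice. *)
Lemma C2_curve F (D : set R) (f f1 f2 : R -> F) : open D ->
  (forall s, D s -> is_derive s 1 f (f1 s)) ->
  (forall s, D s -> is_derive s 1 f1 (f2 s)) ->
  (forall s, D s -> {for s, continuous f2}) -> Ck 2 D f.
Proof.
move=> oD df df1 cf2.
have nD s : D s -> \forall r \near s, D r by move=> Ds; exact: open_nbhs_nbhs.
have DE (h h1 : R -> F) : (forall s, D s -> is_derive s 1 h (h1 s)) ->
    forall s r, D s -> 'D_r h s = r *: h1 s.
  move=> dh s r Ds; have [dhs <-] := dh s Ds.
  have dhs' : differentiable h s by apply/derivable1_diffP.
  by rewrite !deriveE// -linearZ/= [r *: 1]mulr1.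
have dZ r s : D s -> is_derive s 1 ('D_r f) (r *: f2 s).
  move=> Ds; apply: (@near_eq_is_derive _ _ _ (r *: f1)).
    by move: (nD _ Ds); apply: filterS => z Dz; rewrite (DE _ _ df).
  by apply: is_deriveZ; exact: df1.
split => [s Ds|r].
  by apply/derivable1_diffP; have [] := df s Ds.
split => [s Ds|r' s Ds].
  by apply/derivable1_diffP; have [] := dZ r s Ds.
rewrite /prop_for/continuous_at (DE _ _ (dZ r))//.
have : (r' *: (r *: f2 z)) @[z --> s] --> r' *: (r *: f2 s).
  by apply: cvgZl_tmp; apply: cvgZl_tmp; exact: cf2.
apply: cvg_trans; apply: near_eq_cvg.
by move: (nD _ Ds); apply: filterS => z Dz; rewrite (DE _ _ (dZ r)).
Qed.

End Smooth.

(** * Charts and the Euler-Lagrange equations *)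

Section LinearDerive.
Context {R : realType}.

Lemma is_derive_linear (E F : normedModType R) (f : {linear E -> F}) (x e : E) :
  continuous f -> is_derive x e f (f e).
Proof.
move=> cf; have df : differentiable f x by exact: linear_differentiable.
apply: DeriveDef; first exact: diff_derivable.
by rewrite deriveE// diff_lin.
Qed.

End LinearDerive.

(** * Lagrangian mechanics in coordinates *)

Section Bilinear.
Context {R : realType} {n : nat}.

Definition bilin (g : 'I_n -> 'I_n -> 'rV[R]_n -> R) y (v w : 'rV[R]_n) : R :=
  \sum_i \sum_j g i j y * v 0 i * w 0 j.

Lemma bilinC g y v w : (forall i j, g i j y = g j i y) ->
  bilin g y v w = bilin g y w v.
Proof.
move=> gs; rewrite /bilin exchange_big; apply: eq_bigr => i _; apply: eq_bigr => j _.
by rewrite gs; ring.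
Qed.

Lemma is_derive_bilin (g : 'I_n -> 'I_n -> 'rV[R]_n -> R) (V : normedModType R)
    (f a b : V -> 'rV[R]_n) (x e : V) (da db : 'rV[R]_n) :
  differentiable f x -> (forall i j, differentiable (g i j) (f x)) ->
  is_derive x e a da -> is_derive x e b db ->
  is_derive x e (fun z => bilin g (f z) (a z) (b z))
   (bilin (fun i j => 'D_('D_e f x) (g i j)) (f x) (a x) (b x) +
    (bilin g (f x) da (b x) + bilin g (f x) (a x) db)).
Proof.
move=> df dg dA dB.
rewrite /bilin -!big_split/=; apply: is_derive_bigsum => i.
rewrite -!big_split/=; apply: is_derive_bigsum => j.
have d1 := @is_derive_comp _ _ _ _ _ f x e df (dg i j).
have d2 := is_derive_coord 0 i dA.
have d3 := is_derive_coord 0 j dB.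
have d12 := is_deriveM d1 d2.
refine (is_derive_eq (is_deriveM d12 d3) _).
rewrite /= -![_ *: _]/(_ * _) !fctE/=; ring.
Qed.

Lemma bilin_sum g y (v w : 'rV[R]_n) :
  bilin g y v w = \sum_i v 0 i * (\sum_j g i j y * w 0 j).
Proof.
by apply: eq_bigr => i _; rewrite mulr_sumr; apply: eq_bigr => j _; ring.
Qed.

(** The conjugate momentum: the derivative of the Lagrangian in the [i]-th velocity, for symmetric
    [g]. The factor 2 is there because the kinetic term carries no one half. *)
Definition momentum (g : 'I_n -> 'I_n -> 'rV[R]_n -> R) (x v : 'rV[R]_n) i : R :=
  2 * \sum_j g i j x * v 0 j.

Lemma momentum_pairing g x (v w : 'rV[R]_n) :
  2 * bilin g x w v = \sum_i momentum g x v i * w 0 i.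
Proof.
rewrite bilin_sum mulr_sumr; apply: eq_bigr => i _; rewrite /momentum; ring.
Qed.

(** The derivative of the Lagrangian in the [i]-th position coordinate. *)
Definition force (g : 'I_n -> 'I_n -> 'rV[R]_n -> R) (u : 'rV[R]_n -> R)
    (x v : 'rV[R]_n) i : R :=
  bilin (fun j k => 'D_(delta_mx 0 i) (g j k)) x v v - 'D_(delta_mx 0 i) u x.

(** Derivatives are linear in the direction [w]. With the velocity as [w] this serves the
    conservation of energy, with the vector field as [w] the momentum estimate. *)
Lemma force_pairing g u x (v w : 'rV[R]_n) :
  (forall i j, differentiable (g i j) x) -> differentiable u x ->
  bilin (fun j k => 'D_w (g j k)) x v v - 'D_w u x = \sum_i force g u x v i * w 0 i.
Proof.
move=> dg du.
rewrite (diff_sum_delta w du) /force.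
under [RHS]eq_bigr do rewrite mulrBl.
rewrite sumrB; congr (_ - _); last by apply: eq_bigr => i _; rewrite mulrC.
rewrite /bilin; under [RHS]eq_bigr do rewrite mulr_suml.
rewrite [RHS]exchange_big; apply: eq_bigr => j _ /=.
under [RHS]eq_bigr do rewrite mulr_suml.
rewrite [RHS]exchange_big; apply: eq_bigr => k _ /=.
rewrite (diff_sum_delta w (dg j k)) !mulr_suml; apply: eq_bigr => i _.
by rewrite -[_ *: _]/(_ * _); ring.
Qed.

(* Euler-Lagrange equations of [bilin g x v v - u x] on [O]. *)
Record solution (g : 'I_n -> 'I_n -> 'rV[R]_n -> R) (u : 'rV[R]_n -> R)
    (O : set 'rV[R]_n) (J : set R) (q v a : R -> 'rV[R]_n) : Prop := Solution {
  sol_dom : forall t, J t -> O (q t);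
  sol_dq : forall t, J t -> is_derive t 1 q (v t);
  sol_dv : forall t, J t -> is_derive t 1 v (a t);
  sol_ca : forall t, J t -> {for t, continuous a};
  sol_EL : forall t i, J t ->
    is_derive t 1 (fun s => momentum g (q s) (v s) i) (force g u (q t) (v t) i)
}.

End Bilinear.

(** * Changes of charts on the tangent bundle *)

Section Charts.
Context {R : realType} {n : nat} {M : smooth_manifold R n}.
Implicit Types c d e : chart R n M.

(** All tangent spaces are the same type of row vectors, so vectors over equal base points can be
    compared without transport. *)
Lemma TPoint_eq (x y : M) (v w : 'rV[R]_n) : x = y -> v = w ->
  TPoint (v : tangent x) = TPoint (w : tangent y).
Proof. by move=> xy; subst y => ->. Qed.

Definition transition_dom c d : set 'rV[R]_n :=
  [set y | cimg c y /\ cdom d (cinv c y)].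

Lemma near_cimg c y : cimg c y -> \forall z \near y, cimg c z.
Proof. by move=> cy; apply: open_nbhs_nbhs; split; [exact: cimg_open|]. Qed.

Lemma near_cdom d (T : topologicalType) (f : T -> M) t :
  {for t, continuous f} -> cdom d (f t) -> \forall s \near t, cdom d (f s).
Proof. by move=> ft df; apply: ft; apply: open_nbhs_nbhs; split; [exact: cdom_open|]. Qed.

Lemma near_transition c d y :
  transition_dom c d y -> \forall z \near y, transition_dom c d z.
Proof.
move=> [cy dy]; near=> z; split; near: z; first exact: near_cimg.
apply: (@near_cdom d _ (cinv c) y) => //; exact: cinv_cont.
Unshelve. all: by end_near. Qed.

Lemma open_transition_dom c d : open (transition_dom c d).
Proof. by rewrite openE => y; exact: near_transition. Qed.

Lemma transition_smooth c d : atlas c -> atlas d ->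
  smooth_on (transition_dom c d) (cmap d \o cinv c).
Proof. exact: atlas_compat. Qed.

Lemma transition_diff c d y : atlas c -> atlas d -> transition_dom c d y ->
  differentiable (cmap d \o cinv c) y.
Proof. by move=> ac ad; exact/smooth_on_diff/transition_smooth. Qed.

Lemma transition_dom_sym c d y : transition_dom c d y ->
  transition_dom d c (cmap d (cinv c y)).
Proof.
move=> [cy dy]; split; first exact: cmap_img.
by rewrite cmapK//; exact: cinv_dom.
Qed.

(** The chain rule for three charts. With one of them selected by [chart_at], it relates the stored
    components of a tangent vector to its components in the other charts. *)
Lemma transition_chain c d e y u : atlas c -> atlas d -> atlas e ->
  transition_dom c d y -> cdom e (cinv c y) ->
  'd (cmap e \o cinv d) (cmap d (cinv c y)) ('d (cmap d \o cinv c) y u) =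
  'd (cmap e \o cinv c) y u.
Proof.
move=> ac ad ae cdy ey; have [cy dy] := cdy.
have dcd := transition_diff ac ad cdy.
have dce := transition_diff ac ae (conj cy ey).
have dde : differentiable (cmap e \o cinv d) (cmap d (cinv c y)).
  by apply: transition_diff => //; split; [exact: cmap_img|rewrite cmapK].
apply: (etrans (diff_comp_derive u dcd dde)); apply: (etrans _ (deriveE u dce)).
apply: near_eq_derive.
by apply: filterS (near_transition cdy) => z [cz dz] /=; rewrite cmapK.
Qed.

Lemma transition_id c y u : cimg c y -> 'd (cmap c \o cinv c) y u = u.
Proof.
move=> cy; have idE : \forall z \near y, z = (cmap c \o cinv c) z.
  by apply: filterS (near_cimg cy) => z cz /=; rewrite cinvK.
have did : differentiable (cmap c \o cinv c) y.
  exact: near_eq_differentiable idE _.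
by rewrite -deriveE// -(near_eq_derive u idE) derive_id.
Qed.

Lemma tcoord_tparam c y u : atlas c -> cimg c y ->
  tcoord c (tvec (tparam c y u)) = u.
Proof.
move=> ac cy; rewrite /tcoord/= transition_chain ?transition_id//.
- exact: chart_at_atlas.
- by split=> //; exact: chart_at_dom.
- exact: cinv_dom.
Qed.

Lemma tparam_change c d x w : atlas c -> atlas d -> transition_dom d c x ->
  tparam d x w = tparam c (cmap c (cinv d x)) ('d (cmap c \o cinv d) x w).
Proof.
move=> ac ad dcx; have [dx cx] := dcx; apply: TPoint_eq; first by rewrite (cmapK cx).
rewrite (cmapK cx); apply: esym; apply: transition_chain => //.
- exact: chart_at_atlas.
- exact: chart_at_dom.
Qed.

(** * Covariance of the Euler-Lagrange equations *)

Section EulerLagrange.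
Variables (Q : forall x : M, tangent x -> R) (U : M -> R) (c : chart R n M).
Variable g : 'I_n -> 'I_n -> 'rV[R]_n -> R.
Hypothesis U_smooth : smooth_function U.
Hypothesis ac : atlas c.
Hypothesis g_smooth : forall i j, smooth_on (cimg c) (g i j).
Hypothesis g_sym : forall i j y, cimg c y -> g i j y = g j i y.
Hypothesis Q_g : forall x (v : tangent x), cdom c x ->
  Q v = \sum_i \sum_j g i j (cmap c x) * tcoord c v 0 i * tcoord c v 0 j.
Local Notation L := (lagrangian Q U).
Local Notation u := (U \o cinv c).

Lemma Q_tparam y v : cimg c y ->
  Q (tvec (tparam c y v)) = bilin g y v v.
Proof.
move=> cy; rewrite Q_g; last exact: cinv_dom.
by rewrite tcoord_tparam// /= cinvK.
Qed.

Lemma lagrangian_tparam y v : cimg c y ->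
  L (tparam c y v) = bilin g y v v - u y.
Proof. by move=> cy; rewrite /lagrangian Q_tparam. Qed.

Variables (d : chart R n M).
Hypothesis ad : atlas d.
Local Notation psi := (cmap c \o cinv d).

Lemma lagrangian_transition x w : transition_dom d c x ->
  L (tparam d x w) = bilin g (psi x) ('D_w psi x) ('D_w psi x) - u (psi x).
Proof.
move=> xD; have dpsi := transition_diff ad ac xD; have [dx cx] := xD.
rewrite (tparam_change w ac ad xD) lagrangian_tparam ?(deriveE _ dpsi)//.
exact: cmap_img.
Qed.

Lemma lagrangian_velocity x w (e : 'rV[R]_n) : transition_dom d c x ->
  'D_e (fun w => L (tparam d x w)) w =
  2 * bilin g (psi x) ('D_e psi x) ('D_w psi x).
Proof.
move=> xD; have dpsi := transition_diff ad ac xD; have [dx cx] := xD.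
have cpsi : cimg c (psi x) by exact: cmap_img.
have -> : (fun w => L (tparam d x w)) =
    (fun w => bilin g (psi x) ('d psi x w) ('d psi x w)) - cst (u (psi x)).
  by apply/funext => v; rewrite lagrangian_transition// (deriveE _ dpsi).
have dl := is_derive_linear w e (diff_continuous dpsi).
have dg i j : differentiable (g i j) (psi x) by exact: smooth_on_diff (g_smooth i j) cpsi.
have db := is_derive_bilin (differentiable_cst (psi x) w) dg dl dl.
have dd := is_deriveB db (is_derive_cst (u (psi x)) w e).
rewrite (@derive_val _ _ _ _ _ _ _ dd) /cst derive_cst subr0.
rewrite [X in X + _](_ : _ = 0); last first.
  by apply: big1 => i _; apply: big1 => j _; rewrite derive0 !mul0r.
rewrite add0r [X in _ + X]bilinC; last by move=> i j; exact: g_sym.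
by rewrite -!(deriveE _ dpsi); ring.
Qed.

Lemma lagrangian_position x w (e : 'rV[R]_n) : transition_dom d c x ->
  'D_e (fun x => L (tparam d x w)) x =
  bilin (fun i j => 'D_('D_e psi x) (g i j)) (psi x) ('D_w psi x) ('D_w psi x) +
  2 * bilin g (psi x) ('D_w ('D_e psi) x) ('D_w psi x) - 'D_('D_e psi x) u (psi x).
Proof.
move=> xD; have dpsi := transition_diff ad ac xD; have [dx cx] := xD.
have cpsi : cimg c (psi x) by exact: cmap_img.
have near_D := near_transition xD.
have -> : 'D_e (fun x => L (tparam d x w)) x =
    'D_e ((fun x => bilin g (psi x) ('D_w psi x) ('D_w psi x)) - (u \o psi)) x.
  apply: near_eq_derive; apply: filterS near_D => z zD.
  by rewrite lagrangian_transition.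
have spsi := transition_smooth ad ac.
have dwpsi : differentiable ('D_w psi) x.
  by apply: smooth_on_diff xD; exact: smooth_on_derive.
have dW : is_derive x e ('D_w psi) ('D_e ('D_w psi) x).
  by apply: DeriveDef => //; exact: diff_derivable.
have dg i j : differentiable (g i j) (psi x) by exact: smooth_on_diff (g_smooth i j) cpsi.
have db := is_derive_bilin dpsi dg dW dW.
have du : differentiable u (psi x) by exact: smooth_on_diff (U_smooth ac) cpsi.
have dd := is_deriveB db (is_derive_comp e dpsi du).
rewrite (@derive_val _ _ _ _ _ _ _ dd).
(* The swap turns this term into the one that arises in [curve_euler_lagrange] when ['D_e psi] is
   differentiated along the motion. *)
rewrite (mixed_derive w e (open_transition_dom (c:=d) (d:=c)) spsi xD).
rewrite [X in _ + (_ + X)]bilinC; last by move=> i j; exact: g_sym.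
by ring.
Qed.

Variables (J : set R) (q v a : R -> 'rV[R]_n).
Hypothesis oJ : open J.
Hypothesis q_cimg : forall t, J t -> cimg c (q t).
Hypothesis dq : forall t, J t -> is_derive t 1 q (v t).
Hypothesis dv : forall t, J t -> is_derive t 1 v (a t).
Hypothesis ca : forall t, J t -> {for t, continuous a}.
Hypothesis EL : forall t i, J t ->
  is_derive t 1 (fun s => momentum g (q s) (v s) i) (force g u (q t) (v t) i).

Let gam := cinv c \o q.
Let phi := cmap d \o cinv c.
Let qd := cmap d \o gam.

Lemma curve_continuous t : J t -> {for t, continuous gam}.
Proof.
move=> Jt; apply: continuous_comp; first exact: is_derive_continuous (dq Jt).
exact/cinv_cont/q_cimg.
Qed.

Let D := J `&` gam @^-1` cdom d.

Lemma curve_transition_dom t : D t -> transition_dom c d (q t).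
Proof. by move=> [Jt dt]; split => //; exact: q_cimg. Qed.

Lemma near_curve_dom t : D t -> \forall s \near t, D s.
Proof.
move=> [Jt dt]; near=> s; split; near: s; first exact: open_nbhs_nbhs.
apply: (@near_cdom d _ gam t) => //; exact: curve_continuous.
Unshelve. all: by end_near. Qed.

Lemma open_curve_dom : open D.
Proof. by rewrite openE => t; exact: near_curve_dom. Qed.

Lemma curve_derive t : D t -> is_derive t 1 qd ('D_(v t) phi (q t)).
Proof.
move=> Dt; apply: (@is_derive_curve _ _ _ phi q) => //; first by case: Dt => /dq.
exact: (transition_diff ac ad (curve_transition_dom Dt)).
Qed.

Lemma curve_transitionK t : D t -> psi (qd t) = q t.
Proof.
move=> [Jt dt]; rewrite /qd/= cmapK// /gam/= cinvK//; exact: q_cimg.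
Qed.

Lemma curve_velocityK t : D t -> 'D_('D_(v t) phi (q t)) psi (qd t) = v t.
Proof.
move=> Dt; have cdq := curve_transition_dom Dt; have dcq := transition_dom_sym cdq.
have dphi := transition_diff ac ad cdq; have dpsi := transition_diff ad ac dcq.
rewrite (deriveE _ dpsi) (deriveE _ dphi).
have [cq dd] := cdq.
exact: (etrans (transition_chain (v t) ac ad ac cdq (cinv_dom cq))
               (transition_id (v t) cq)).
Qed.

Lemma curve_C2 : Ck 2 D qd.
Proof.
(* Expanding in the basis makes the directions of derivation constant, so that the velocity can be
   differentiated again term by term. *)
pose w1 s : 'rV[R]_n := \sum_k v s 0 k *: 'D_(delta_mx 0 k) phi (q s).
pose w2 s : 'rV[R]_n := \sum_k (a s 0 k *: 'D_(delta_mx 0 k) phi (q s) +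
  v s 0 k *: \sum_l v s 0 l *: 'D_(delta_mx 0 l) ('D_(delta_mx 0 k) phi) (q s)).
have sphi := transition_smooth ac ad.
apply: (@C2_curve _ _ _ _ w1 w2 open_curve_dom) => s Ds.
- apply: is_derive_eq (curve_derive Ds) _.
  exact/diff_sum_delta/(transition_diff ac ad (curve_transition_dom Ds)).
- have [Js _] := Ds; have cdq := curve_transition_dom Ds.
  apply: is_derive_bigsum => k; apply: is_derive_mx => i j.
  have dk : differentiable ('D_(delta_mx 0 k) phi) (q s).
    by apply: smooth_on_diff cdq; exact: smooth_on_derive.
  have d1 := is_derive_coord 0 k (dv Js).
  have d2 := is_derive_coord i j (is_derive_curve (dq Js) dk).
  rewrite (diff_sum_delta _ dk) in d2.
  have -> : (fun x => (v x 0 k *: 'D_(delta_mx 0 k) phi (q x)) i j) =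
     (fun x => v x 0 k) * (fun x => ('D_(delta_mx 0 k) phi \o q) x i j).
    by apply/funext => x; rewrite mxE.
  refine (is_derive_eq (is_deriveM d1 d2) _).
  by rewrite ord1 !mxE /= -![_ *: _]/(_ * _) addrC [_ * a s 0 k]mulrC.
- have [Js _] := Ds; have cdq := curve_transition_dom Ds.
  have cq : {for s, continuous q} := is_derive_continuous (dq Js).
  have cv k : {for s, continuous (fun s => v s 0 k)}.
    exact: is_derive_continuous (is_derive_coord 0 k (dv Js)).
  have cak k : {for s, continuous (fun s => a s 0 k)}.
    apply: (@continuous_comp _ _ _ a (fun N : 'rV[R]_n => N 0 k)); first exact: ca.
    exact: coord_continuous.
  have cphi1 k : {for s, continuous ('D_(delta_mx 0 k) phi \o q)}.
    apply: continuous_comp; first exact: cq.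
    by apply: smooth_on_cont cdq; exact: smooth_on_derive.
  have cphi2 k l : {for s, continuous ('D_(delta_mx 0 l) ('D_(delta_mx 0 k) phi) \o q)}.
    apply: continuous_comp; first exact: cq.
    by apply: smooth_on_cont cdq; do 2 apply: smooth_on_derive.
  rewrite /w2; apply: cvg_big => [|k _]; first exact: add_continuous.
  apply: cvgD; first by apply: cvgZ; [exact: cak|exact: cphi1].
  apply: cvgZ; first exact: cv.
  apply: cvg_big => [|l _]; first exact: add_continuous.
  by apply: cvgZ; [exact: cv|exact: cphi2].
Qed.

(* Euler-Lagrange is covariant: the second derivatives of the transition map
   occur on both sides and cancel because they are symmetric. *)
Lemma curve_euler_lagrange t : D t -> euler_lagrange_at L d gam t.
Proof.
move=> Dt; rewrite /euler_lagrange_at -/qd => i.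
have [Jt _] := Dt.
have cdq := curve_transition_dom Dt; have dcq := transition_dom_sym cdq.
have spsi := transition_smooth ad ac.
have [cq _] := cdq.
set w := 'D_(v t) phi (q t).
have dE s : D s -> derive1 qd s = 'D_(v s) phi (q s).
  by move=> Ds; rewrite derive1E; have [_ ->] := curve_derive Ds.
(* The [i]-th coordinate vector of [d] as seen in [c]: the [i]-th momentum in [d] is the momentum in
   [c] paired with [B]. *)
pose B := 'D_(delta_mx 0 i) psi.
have dB : differentiable B (qd t).
  by apply: smooth_on_diff dcq; exact: smooth_on_derive.
have d1 k := is_deriveM (EL k Jt) (is_derive_coord 0 k (is_derive_curve (curve_derive Dt) dB)).
have d2 := is_derive_bigsum (index_enum 'I_n) d1.
apply: (@near_eq_is_derive _ _ _
    (fun s => \sum_k momentum g (q s) (v s) k * B (qd s) 0 k)).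
  apply: filterS (near_curve_dom Dt) => s Ds.
  have dcqs := transition_dom_sym (curve_transition_dom Ds).
  rewrite (dE _ Ds) (lagrangian_velocity _ _ dcqs) -momentum_pairing.
  by rewrite (curve_transitionK Ds) (curve_velocityK Ds).
apply: is_derive_eq d2 _.
have dgq j k : differentiable (g j k) (q t) by exact: smooth_on_diff (g_smooth j k) cq.
have duq : differentiable u (q t) by exact: smooth_on_diff (U_smooth ac) cq.
rewrite (dE _ Dt) (lagrangian_position _ _ dcq) (curve_transitionK Dt) (curve_velocityK Dt).
rewrite big_split/= [LHS]addrC addrAC (force_pairing _ _ dgq duq); congr (_ + _).
  by apply: eq_bigr => k _; rewrite -[_ *: _]/(_ * _) mulrC.
by rewrite momentum_pairing.
Qed.

End EulerLagrange.

Section Solutions.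
Variables (Q : forall x : M, tangent x -> R) (U : M -> R) (c : chart R n M).
Variable g : 'I_n -> 'I_n -> 'rV[R]_n -> R.
Hypothesis U_smooth : smooth_function U.
Hypothesis ac : atlas c.
Hypothesis g_smooth : forall i j, smooth_on (cimg c) (g i j).
Hypothesis g_sym : forall i j y, cimg c y -> g i j y = g j i y.
Hypothesis Q_g : forall x (v : tangent x), cdom c x ->
  Q v = \sum_i \sum_j g i j (cmap c x) * tcoord c v 0 i * tcoord c v 0 j.
Local Notation u := (U \o cinv c).

(** A [motion] must be C2 and satisfy the equations in every chart of the atlas; covariance reduces
    this to the one chart in which the curve is constructed. *)
Lemma motion_of_solution (J : set R) (q v a : R -> 'rV[R]_n) : open J -> is_interval J ->
  solution g u (cimg c) J q v a -> motion (lagrangian Q U) J (cinv c \o q).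
Proof.
move=> oJ iJ [qc dq dv ca EL]; split => // [t Jt|d ad].
  exact: curve_continuous dq _ Jt.
split; first exact: (curve_C2 ac ad oJ qc dq dv ca).
move=> t Jt dt.
exact: (@curve_euler_lagrange Q U c g U_smooth ac g_smooth g_sym Q_g d ad J q v oJ qc dq EL).
Qed.

Lemma tangent_lift_solution (J : set R) (q v a : R -> 'rV[R]_n) t : open J ->
  solution g u (cimg c) J q v a -> J t ->
  tangent_lift (cinv c \o q) t = tparam c (q t) (v t).
Proof.
move=> oJ [qc dq dv ca EL] Jt; apply: TPoint_eq => //.
have ad := chart_at_atlas ((cinv c \o q) t).
have dom := chart_at_dom ((cinv c \o q) t).
rewrite /velocity derive1E.
apply: (etrans (@derive_val _ _ _ _ _ _ _ (curve_derive ac ad qc dq (conj Jt dom)))).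
by apply: deriveE; apply: transition_diff => //; split => //; exact: qc.
Qed.

(** [lie_derivative] is computed in the chart selected at the point; the chain rule moves it to [c],
    where the estimates take place. *)
Lemma lie_derivative_chart (V : forall x : M, tangent x) y : cimg c y ->
  lie_derivative V U (cinv c y) = 'D_(tcoord c (V (cinv c y))) u y.
Proof.
move=> cy; rewrite /lie_derivative /tcoord.
set x := cinv c y; set e := chart_at x; set ex := cmap e x.
have ae : atlas e := chart_at_atlas x.
have ecx : transition_dom e c ex.
  by split; [exact/cmap_img/chart_at_dom|rewrite cmapK; [exact: cinv_dom|exact: chart_at_dom]].
have psix : (cmap c \o cinv e) ex = y.
  by rewrite /= cmapK ?cinvK//; exact: chart_at_dom.
have dpsi := transition_diff ae ac ecx.
have du : differentiable u ((cmap c \o cinv e) ex).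
  by rewrite psix; exact: smooth_on_diff (U_smooth ac) cy.
have dUe : differentiable (U \o cinv e) ex.
  by apply: smooth_on_diff (U_smooth ae) _; case: ecx.
have := diff_comp_derive (V x) dpsi du; rewrite psix => E.
rewrite psix in du.
apply: (etrans (esym (deriveE _ dUe))); apply: (etrans _ (esym (deriveE _ du))).
apply: (etrans _ (esym E)); apply: near_eq_derive.
by apply: filterS (near_transition ecx) => z [ez cz] /=; rewrite cmapK.
Qed.

Lemma bilin_gt0 y v : positive_definite Q -> cimg c y -> v != 0 ->
  0 < bilin g y v v.
Proof.
move=> Qpos cy v0; rewrite -(Q_tparam ac Q_g _ cy); apply: Qpos.
apply: contra_neq v0 => v0; rewrite -(tcoord_tparam v ac cy) v0 /tcoord linear0//.
Qed.

End Solutions.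

End Charts.

(** * Global solutions of Lipschitz differential equations *)

Section Antiderivative.
Context {R : realType}.

Lemma antiderivative (f : R -> R) : continuous f ->
  exists G : R -> R, G 0 = 0 /\ forall t : R, is_derive t 1 G (f t).
Proof.
move=> cf.
pose A (N x : R) : R := (\int[lebesgue_measure]_(t in `[- N, x]) f t)%R.
have dA (N x : R) : - N < x -> is_derive x 1 (A N) (f x).
  move=> Nx; have [|||dx dxE] := @continuous_FTC1_closed R f (- N) x (x + 1) _ _ _ (cf x).
  - by rewrite ltrDl.
  - apply: continuous_compact_integrable; first exact: segment_compact.
    exact: continuous_subspaceT.
  - exact: Nx.
  - by split; [exact: dx|rewrite -derive1E; exact: dxE].
(* Moving the lower end [- N] only adds a constant: the difference of the two integrals has
   derivative 0 between 0 and [t]. *)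
have Acst (N N' : R) (t : R) : `|t| < N -> `|t| < N' -> A N t - A N 0 = A N' t - A N' 0.
  move=> tN tN'.
  have dH (s : R) : `|s| <= `|t| -> is_derive s 1 (A N - A N') 0.
    move=> st; rewrite -(subrr (f s)); apply: is_deriveB; apply: dA.
      by have := le_lt_trans st tN; rewrite ltr_norml => /andP[].
    by have := le_lt_trans st tN'; rewrite ltr_norml => /andP[].
  have swap (x y z w : R) : y - w = x - z -> x - y = z - w by lra.
  suff H a b : a <= b -> (forall s, s \in `[a, b] -> `|s| <= `|t|) ->
      (A N - A N') a = (A N - A N') b.
    have [t0|t0] := leP 0 t.
      have := H 0 t t0; rewrite !fctE => HH.
      by apply: swap; apply: HH => s; rewrite in_itv/= => /andP[s0 st]; rewrite !ger0_norm.
    have := H t 0 (ltW t0); rewrite !fctE => HH.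
    apply/swap/esym; apply: HH => s; rewrite in_itv/= => /andP[s0 st].
    by rewrite !ler0_norm ?lerN2// ltW.
  move=> ab Hs.
  have [||c _] := @MVT_segment R (A N - A N') (cst 0) a b ab.
  - by move=> s sab; apply: dH; apply: Hs; exact: subset_itv_oo_cc.
  - apply: derivable_within_continuous => s sab.
    by have [] := dH s (Hs s sab).
  by rewrite mul0r => /eqP; rewrite subr_eq0 => /eqP.
(* The base point recedes with [t], since only integrals over a compact interval
   to the right of the base point are available. *)
exists (fun t => A (`|t| + 1) t - A (`|t| + 1) 0); split; first by rewrite subrr.
move=> t; have lt1 (s : R) : `|s| < `|s| + 1 by rewrite ltrDl.
apply: (@near_eq_is_derive _ _ _ (fun s => A (`|t| + 2) s - A (`|t| + 2) 0)).
  have ct : `|s| @[s --> t] --> `|t| by apply: cvg_norm; exact: cvg_id.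
  have t2 : `|t| < `|t| + 2 by rewrite ltrDl.
  apply: filterS (cvgr_lt _ ct _ t2) => s st.
  by apply: Acst; [exact: st|exact: lt1].
have t2 : - (`|t| + 2) < t.
  by rewrite ltrNl -subr_lt0; have := ler_norm (- t); rewrite normrN; lra.
apply: (is_derive_eq (is_deriveB (dA _ _ t2) (is_derive_cst (A (`|t| + 2) 0) t 1))).
by rewrite subr0.
Qed.

(** The right-hand side is an antiderivative [E] of the bound on [f], so [E - G] does not decrease,
    and it is nonnegative at 0. *)
Lemma antiderivative_le (G f : R -> R) (K c : R) : 0 < K -> 0 <= c -> G 0 = 0 ->
  (forall s : R, 0 <= s -> is_derive s 1 G (f s)) ->
  (forall s, 0 <= s -> f s <= c * expR (K * s)) ->
  forall t, 0 <= t -> G t <= c / K * expR (K * t).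
Proof.
move=> K0 c0 G0 dG fle t t0.
pose E (s : R) := c / K * expR (K * s).
have dE (s : R) : is_derive s 1 E (c * expR (K * s)).
  have dK : is_derive s 1 (fun r => K * r) K.
    apply: (is_derive_eq (is_deriveZ K (is_derive_id s (1 : R)))).
    by rewrite -[_ *: _]/(_ * _) mulr1.
  have dd := @is_derive1_comp _ expR (fun r => K * r) s _ _ (is_derive_expR _) dK.
  apply: (is_derive_eq (is_deriveZ (c / K) dd)).
  by rewrite -![_ *: _]/(_ * _); field; rewrite gt_eqF.
have [||x xt] := @MVT_segment R (E - G) (fun s => c * expR (K * s) - f s) 0 t t0.
- by move=> s; rewrite in_itv/= => /andP[s0 _]; apply: is_deriveB; exact/dG/ltW.
- apply: derivable_within_continuous => s; rewrite in_itv/= => /andP[s0 _].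
  by have [] := is_deriveB (dE s) (dG s s0).
move: xt; rewrite in_itv/= subr0 => /andP[x0 _] EG.
have : 0 <= (E - G) t - (E - G) 0 by rewrite EG mulr_ge0// subr_ge0 fle.
rewrite !fctE G0 subr0 subr_ge0 => H.
have : 0 <= E t - G t.
  by apply: le_trans H; rewrite /E mulr_ge0 ?expR_ge0// divr_ge0// ltW.
by rewrite subr_ge0.
Qed.

(** The one-sided bound is applied to [G] and to [- G], and to the time-reversed function for
    negative times. *)
Lemma antiderivative_norm_le (G f : R -> R) (K c : R) : 0 < K -> 0 <= c -> G 0 = 0 ->
  (forall s : R, is_derive s 1 G (f s)) ->
  (forall s, `|f s| <= c * expR (K * `|s|)) ->
  forall t, `|G t| <= c / K * expR (K * `|t|).
Proof.
move=> K0 c0 G0 dG fle.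
have pos (H h : R -> R) : H 0 = 0 -> (forall s : R, is_derive s 1 H (h s)) ->
  (forall s, `|h s| <= c * expR (K * `|s|)) ->
  forall t, 0 <= t -> `|H t| <= c / K * expR (K * t).
  move=> H0 dH hle t t0; rewrite ler_norml lerNl; apply/andP; split.
    apply: (@antiderivative_le (- H) (- h)) => //.
    - by rewrite fctE H0 oppr0.
    - move=> s s0; have := hle s; rewrite (ger0_norm s0); apply: le_trans.
      by rewrite fctE -normrN ler_norm.
  apply: (@antiderivative_le H h) => // s s0.
  by have := hle s; rewrite (ger0_norm s0); apply: le_trans; exact: ler_norm.
move=> t; have [t0|t0] := leP 0 t.
  by rewrite (ger0_norm t0); exact: (pos G f).
rewrite (ltr0_norm t0) -{1}[t]opprK.
apply: (pos (fun s => G (- s)) (fun s => - f (- s))).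
- by rewrite oppr0.
- move=> s; have dN : is_derive s 1 (-%R : R -> R) (-1) by exact: is_deriveNid.
  by apply: (is_derive_eq (@is_derive1_comp _ G -%R s _ _ (dG (- s)) dN)); rewrite mulrN1.
- by move=> s; rewrite normrN; have := fle (- s); rewrite normrN.
- by rewrite oppr_ge0 ltW.
Qed.

End Antiderivative.

(** * Picard iteration on the whole line *)

Section Picard.
Context {R : realType}.

Lemma le0_geometric (a C : R) : (forall k : nat, a <= C / 2 ^+ k) -> a <= 0.
Proof.
move=> aC; rewrite leNgt; apply/negP => a0.
have C0 : 0 < C by have := aC 0; rewrite expr0 divr1; exact: lt_le_trans.
have [k Ck] : exists k : nat, C / a < k%:R.
  by exists (Num.truncn (C / a)).+1; exact: truncnS_gt.
have := aC k; rewrite leNgt => /negP; apply.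
rewrite ltr_pdivrMr ?exprn_gt0// mulrC -ltr_pdivrMr// (lt_trans Ck)//.
by rewrite -natrX ltr_nat ltn_expl.
Qed.

Lemma exists_geometric_lt (e C : R) : 0 < e -> exists k : nat, C / 2 ^+ k < e.
Proof.
move=> e0; apply: contrapT => /forallNP H.
suff : e <= 0 by rewrite leNgt e0.
by apply: (@le0_geometric e C) => k; rewrite leNgt; apply/negP; exact: H.
Qed.

Lemma geometric_increments_cvg (x : nat -> R) (C : R) :
  0 <= C -> (forall k, `|x k.+1 - x k| <= C / 2 ^+ k) ->
  exists l, forall k, `|l - x k| <= 2 * C / 2 ^+ k.
Proof.
move=> C0 xC.
(* Subtracting the remaining geometric tail is what lets the induction on [j] close. *)
have dist k j : `|x (k + j)%N - x k| <= 2 * C / 2 ^+ k - 2 * C / 2 ^+ (k + j).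
  elim: j => [|j IH]; first by rewrite addn0 !subrr normr0.
  apply: (le_trans (ler_distD (x (k + j)%N) _ _)); rewrite addnS.
  apply: (le_trans (lerD (xC _) IH)).
  rewrite exprS; have a0 : (2 : R) ^+ (k + j) != 0 by rewrite expf_neq0.
  have : (2 : R) ^+ k != 0 by rewrite expf_neq0.
  move: (2 ^+ (k + j)) (2 ^+ k) a0 => a b a0 b0.
  by rewrite le_eqVlt; apply/orP; left; apply/eqP; field; rewrite a0 b0.
have dist' k j : `|x (k + j)%N - x k| <= 2 * C / 2 ^+ k.
  apply: (le_trans (dist k j)); rewrite lerBlDr lerDl.
  by apply: divr_ge0; [exact: mulr_ge0|exact: exprn_ge0].
have cx : cvgn x.
  apply/cauchy_cvgP/cauchy_exP => e e0.
  have [k ke] := exists_geometric_lt (2 * C) e0.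
  exists (x k); exists k => // m /= km; rewrite -ball_normE /= distrC.
  by rewrite -(subnKC km); exact: le_lt_trans ke.
exists (lim (x @ \oo)) => k.
have cd : `|x m - x k| @[m --> \oo] --> `|lim (x @ \oo) - x k|.
  by apply: cvg_norm; apply: cvgB => //; exact: cvg_cst.
apply: (cvgr_to_le cd); exists k => // j /= kj.
by rewrite -(subnKC kj); exact: dist'.
Qed.

(** The errors of the iterates grow with the absolute value of [t] but are uniform over bounded sets
    of times. This suffices for a continuous limit, which is then a fixed point of the Picard
    map. *)
Theorem picard_global m (F : 'rV[R]_m -> 'rV[R]_m) (K : R) (z0 : 'rV[R]_m) :
  0 < K -> (forall z w, `|F z - F w| <= K * `|z - w|) ->
  exists z : R -> 'rV[R]_m,
    z 0 = z0 /\ forall t : R, is_derive t 1 z (F (z t)).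
Proof.
move=> K0 FK.
have cF : continuous F.
  move=> z; apply/(@cvgrPdist_le _ _ _ (nbhs z)) => e e0.
  have eK : 0 < e / K by rewrite divr_gt0.
  have cz : continuous_at z (@id 'rV[R]_m) by exact: cvg_id.
  have /(@cvgrPdist_le _ _ _ (nbhs z))/(_ _ eK) {}cz := cz.
  apply: filterS cz => w /= zw; apply: (le_trans (FK _ _)).
  by rewrite mulrC -ler_pdivlMr.
have is_derive_cont (z : R -> 'rV[R]_m) dz :
    (forall t : R, is_derive t 1 z (dz t)) -> continuous z.
  by move=> dzt t; exact: is_derive_continuous (dzt t).
(* [choice] needs a value at every curve; at a discontinuous one nothing is required, and the curve
   itself is returned. *)
have [step stepP] : {step : (R -> 'rV[R]_m) -> (R -> 'rV[R]_m) & forall z,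
    continuous z -> step z 0 = z0 /\ forall t : R, is_derive t 1 (step z) (F (z t))}.
  apply: (@choice _ _ (fun (z z' : R -> 'rV[R]_m) => continuous z ->
    z' 0 = z0 /\ forall t : R, is_derive t 1 z' (F (z t)))) => z.
  have [cz|ncz] := pselect (continuous z); last by exists z.
  have ex i : exists G : R -> R, G 0 = 0 /\ forall t : R, is_derive t 1 G (F (z t) 0 i).
    apply: antiderivative => t.
    apply: (@continuous_comp _ _ _ (F \o z) (fun N : 'rV[R]_m => N 0 i)).
      by apply: continuous_comp; [exact: cz|exact: cF].
    exact: coord_continuous.
  have [G GP] := choice ex.
  exists (fun t => \row_i (z0 0 i + G i t)) => _; split.
    by apply/rowP => i; rewrite mxE; have [-> _] := GP i; rewrite addr0.
  move=> t; apply: is_derive_mx => i j; rewrite ord1.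
  have [_ dG] := GP j.
  have -> : (fun x => (\row_i (z0 0 i + G i x)) 0 j) = cst (z0 0 j) + G j.
    by apply/funext => x; rewrite mxE.
  by apply: (is_derive_eq (is_deriveD (is_derive_cst _ _ _) (dG t))); rewrite add0r.
(* The weight [expR (2 * K * `|t|)] makes the Picard map contract by 1/2 on the
   whole line. *)
have stepB (z w dz dw : R -> 'rV[R]_m) c : 0 <= c -> z 0 = w 0 ->
    (forall t : R, is_derive t 1 z (dz t)) -> (forall t : R, is_derive t 1 w (dw t)) ->
    (forall t, `|dz t - dw t| <= c * expR (2 * K * `|t|)) ->
    forall t, `|z t - w t| <= c / (2 * K) * expR (2 * K * `|t|).
  move=> c0 zw0 dz' dw' dzw t; apply: normr_rV_le => [|i].
    by rewrite mulr_ge0 ?expR_ge0// divr_ge0// mulr_ge0// ltW.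
  apply: (@antiderivative_norm_le _ (fun t => (z t - w t) 0 i)
     (fun t => (dz t - dw t) 0 i)).
  - by rewrite mulr_gt0.
  - by [].
  - by rewrite zw0 subrr mxE.
  - by move=> s; apply: is_derive_coord; exact: (is_deriveB (dz' s) (dw' s)).
  - by move=> s; apply: le_trans (dzw s); exact: normr_coord.
pose Z k := iter k step (cst z0).
have cZ k : continuous (Z k).
  elim: k => [|k IH]; first exact: cst_continuous.
  have [_ dz] := stepP _ IH; exact: is_derive_cont dz.
have Z00 k : Z k 0 = z0 by case: k => [//|k]; have [] := stepP _ (cZ k).
have dZ k (t : R) : is_derive t 1 (Z k.+1) (F (Z k t)).
  by have [_] := stepP _ (cZ k); exact.
have K20 : 0 < 2 * K by rewrite mulr_gt0.
pose c0 := `|F z0| / (2 * K).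
have c00 : 0 <= c0 by rewrite divr_ge0// ltW.
have Zinc k t : `|Z k.+1 t - Z k t| <= c0 / 2 ^+ k * expR (2 * K * `|t|).
  elim: k t => [|k IH] t.
    rewrite expr0 divr1; apply: (stepB (Z 1) (Z 0) (fun s => F (Z 0 s)) (cst 0)).
    - exact: normr_ge0.
    - by rewrite !Z00.
    - move=> s; rewrite subr0; apply: ler_peMr; first exact: normr_ge0.
      by rewrite -[leLHS]expR0 ler_expR; apply: mulr_ge0; [exact: ltW|exact: normr_ge0].
  have -> : c0 / 2 ^+ k.+1 = K * (c0 / 2 ^+ k) / (2 * K).
    by rewrite exprS; field; rewrite gt_eqF// expf_neq0.
  apply: (stepB _ _ (fun s => F (Z k.+1 s)) (fun s => F (Z k s))).
  - by rewrite mulr_ge0 ?divr_ge0 ?exprn_ge0// ltW.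
  - by rewrite !Z00.
  - by move=> s; apply: (le_trans (FK _ _)); rewrite -[leRHS]mulrA ler_pM2l.
have [z zP] : {z : R -> 'rV[R]_m & forall t k,
    `|z t - Z k t| <= 2 * (c0 * expR (2 * K * `|t|)) / 2 ^+ k}.
  apply: (@choice _ _ (fun t l => forall k,
    `|l - Z k t| <= 2 * (c0 * expR (2 * K * `|t|)) / 2 ^+ k)) => t.
  have c0E : 0 <= c0 * expR (2 * K * `|t|) by rewrite mulr_ge0// expR_ge0.
  have ex i : exists l, forall k,
      `|l - Z k t 0 i| <= 2 * (c0 * expR (2 * K * `|t|)) / 2 ^+ k.
    apply: (@geometric_increments_cvg (fun k => Z k t 0 i)) => // k.
    rewrite mulrAC; apply: le_trans (Zinc k t).
    by have := normr_coord (Z k.+1 t - Z k t) 0 i; rewrite !mxE.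
  have [l lP] := choice ex; exists (\row_i l i) => k.
  apply: normr_rV_le => [|i]; last by rewrite !mxE.
  by apply: divr_ge0; [exact: mulr_ge0|exact: exprn_ge0].
have cz : continuous z.
  move=> t; apply/cvgrPdist_le => e e0.
  (* The weight at distance 1 beyond [t] dominates the weight at all nearby times, so one index [k]
     serves a whole neighbourhood of [t]. *)
  pose b := 2 * (c0 * expR (2 * K * (`|t| + 1))).
  have e30 : 0 < e / 3 by rewrite divr_gt0.
  have [k ke] := exists_geometric_lt b e30.
  have zZ s : `|s| <= `|t| + 1 -> `|z s - Z k s| <= e / 3.
    move=> st; apply: le_trans (ltW ke); apply: (le_trans (zP s k)).
    rewrite ler_pM2r ?invr_gt0 ?exprn_gt0// /b ler_pM2l// ler_wpM2l//.
    by rewrite ler_expR ler_pM2l.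
  have /cvgrPdist_le/(_ _ e30) nZ : Z k s @[s --> t] --> Z k t by exact: cZ.
  have ct : `|s| @[s --> t] --> `|t| by apply: cvg_norm; exact: cvg_id.
  have t1 : `|t| < `|t| + 1 by rewrite ltrDl.
  apply: filterS (filterI nZ (cvgr_lt _ ct _ t1)) => s /= [Zts st].
  have h1 := zZ t (ltW t1); have h2 := zZ s (ltW st).
  have -> : e = e / 3 + (e / 3 + e / 3) by field.
  apply: (le_trans (ler_distD (Z k t) _ _)); apply: lerD => //.
  apply: (le_trans (ler_distD (Z k s) _ _)); apply: lerD => //.
  by rewrite distrC.
have [w0 dw] := stepP _ cz.
(* [Z k.+1] is close to [z] by convergence and close to [step z] by contraction, with errors that
   decay like [1 / 2 ^+ k]. *)
suff zw : z = step z by exists z; split; [rewrite zw|move=> t; rewrite {1}zw; exact: dw].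
apply/funext => t; apply/eqP; rewrite -subr_eq0 -normr_le0.
apply: (@le0_geometric _ (2 * (c0 * expR (2 * K * `|t|)))) => k.
apply: (le_trans (ler_distD (Z k.+1 t) _ _)).
have h1 := zP t k.+1.
have h2 : `|Z k.+1 t - step z t| <= c0 / 2 ^+ k * expR (2 * K * `|t|).
  have -> : c0 / 2 ^+ k = (K * (2 * c0 / 2 ^+ k)) / (2 * K).
    by field; rewrite gt_eqF// expf_neq0.
  apply: (stepB _ _ (fun s => F (Z k s)) (fun s => F (z s))) => //.
  - by rewrite !mulr_ge0 ?invr_ge0 ?exprn_ge0// ltW.
  - by rewrite Z00 w0.
  - move=> s; apply: (le_trans (FK _ _)); rewrite -[leRHS]mulrA ler_pM2l// distrC.
    by apply: (le_trans (zP s k)); rewrite !mulrA [leRHS]mulrAC.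
apply: (le_trans (lerD h1 h2)); rewrite exprS.
have : (2 : R) ^+ k != 0 by rewrite expf_neq0.
move: (expR _) (2 ^+ k) => E a a0; rewrite le_eqVlt; apply/orP; left; apply/eqP.
by field.
Qed.

End Picard.

(** * The cut-off flow in a chart *)

Section BoundedLipschitz.
Context {R : realType} {m : nat}.
Implicit Types (B : set 'rV[R]_m) (f : 'rV[R]_m -> R).

(** Boundedness is included because it is what keeps products Lipschitz. *)
Definition bounded_lipschitz B f := exists C, [/\ 0 <= C, forall z, B z -> `|f z| <= C &
  forall z w, B z -> B w -> `|f z - f w| <= C * `|z - w|].

Lemma bdlip_ext B f h : (forall z, B z -> f z = h z) ->
  bounded_lipschitz B f -> bounded_lipschitz B h.
Proof.
move=> fh [C [C0 bf lf]]; exists C; split => // [z Bz|z w Bz Bw].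
  by rewrite -fh//; exact: bf.
by rewrite -!fh//; exact: lf.
Qed.

Lemma bdlip_cst B k : bounded_lipschitz B (fun=> k).
Proof.
by exists `|k|; split => // z w _ _; rewrite subrr normr0 mulr_ge0.
Qed.

Lemma bdlip_add B f h : bounded_lipschitz B f -> bounded_lipschitz B h ->
  bounded_lipschitz B (fun z => f z + h z).
Proof.
move=> [C [C0 bf lf]] [D [D0 bh lh]]; exists (C + D); split; first exact: addr_ge0.
  by move=> z Bz; apply: (le_trans (ler_normD _ _)); rewrite lerD ?bf ?bh.
move=> z w Bz Bw; rewrite opprD addrACA mulrDl.
by apply: (le_trans (ler_normD _ _)); rewrite lerD ?lf ?lh.
Qed.

Lemma bdlip_mul B f h : bounded_lipschitz B f -> bounded_lipschitz B h ->
  bounded_lipschitz B (fun z => f z * h z).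
Proof.
move=> [C [C0 bf lf]] [D [D0 bh lh]].
exists (C * D + C * D); split; first by rewrite addr_ge0// mulr_ge0.
  move=> z Bz; rewrite normrM (@le_trans _ _ (C * D))//.
    by rewrite ler_pM ?bf ?bh.
  by rewrite lerDl mulr_ge0.
move=> z w Bz Bw.
have -> : f z * h z - f w * h w = f z * (h z - h w) + (f z - f w) * h w by ring.
apply: (le_trans (ler_normD _ _)); rewrite !normrM [leRHS]mulrDl; apply: lerD.
  by rewrite -mulrA; apply: ler_pM; rewrite ?bf ?lh.
by rewrite mulrAC; apply: ler_pM; rewrite ?bh ?lf.
Qed.

Lemma bdlip_sum B (I : Type) (r : seq I) (P : pred I) (f : I -> 'rV[R]_m -> R) :
  (forall i, bounded_lipschitz B (f i)) ->
  bounded_lipschitz B (fun z => \sum_(i <- r | P i) f i z).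
Proof.
move=> bf; elim: r => [|i r IH].
  by apply: bdlip_ext (bdlip_cst B 0) => z _; rewrite big_nil.
have [Pi|Pi] := boolP (P i).
  by apply: bdlip_ext (bdlip_add (bf i) IH) => z _; rewrite big_cons Pi.
by apply: bdlip_ext IH => z _; rewrite big_cons (negbTE Pi).
Qed.

Lemma bdlip_prod B (I : Type) (r : seq I) (f : I -> 'rV[R]_m -> R) :
  (forall i, bounded_lipschitz B (f i)) ->
  bounded_lipschitz B (fun z => \prod_(i <- r) f i z).
Proof.
move=> bf; elim: r => [|i r IH].
  by apply: bdlip_ext (bdlip_cst B 1) => z _; rewrite big_nil.
by apply: bdlip_ext (bdlip_mul (bf i) IH) => z _; rewrite big_cons.
Qed.

Lemma bdlip_opp B f : bounded_lipschitz B f -> bounded_lipschitz B (fun z => - f z).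
Proof.
move=> /(bdlip_mul (bdlip_cst B (-1))).
by apply: bdlip_ext => z _; rewrite mulN1r.
Qed.

Lemma bdlip_sub B f h : bounded_lipschitz B f -> bounded_lipschitz B h ->
  bounded_lipschitz B (fun z => f z - h z).
Proof. by move=> bf /bdlip_opp; exact: bdlip_add. Qed.

Lemma bdlip_within B f : bounded_lipschitz B f -> {within B, continuous f}.
Proof.
move=> [C [C0 bf lf]].
have C1 : 0 < C + 1 by rewrite ltr_wpDl.
rewrite continuous_subspace_in => z /set_mem Bz.
apply/cvgrPdist_le => e e0; rewrite -(nbhs_subspace_in Bz).
have eC : 0 < e / (C + 1) by rewrite divr_gt0.
have nz : nbhs z [set w | `|z - w| < e / (C + 1)].
  by apply/nbhs_ballP; exists (e / (C + 1)) => // w; rewrite -ball_normE.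
rewrite /within /=; apply: filterS nz => w /= zw Bw.
apply: (le_trans (lf _ _ Bz Bw)).
rewrite (@le_trans _ _ ((C + 1) * `|z - w|))//; first by rewrite ler_wpM2r// lerDl.
by rewrite mulrC -ler_pdivlMr// ltW.
Qed.

(** By compactness the absolute value of [f] has a positive minimum [a]; a difference of inverses is
    a difference of values over a product of size at least [a ^+ 2]. *)
Lemma bdlip_inv B f : compact B -> bounded_lipschitz B f ->
  (forall z, B z -> f z != 0) ->
  bounded_lipschitz B (fun z => (f z)^-1).
Proof.
move=> cB bf f0.
have [[z0 Bz0]|nB] := pselect (B !=set0); last first.
  have nBz z : B z -> False by move=> Bz; apply: nB; exists z.
  by exists 0; split => // [z /nBz|z w /nBz].
have cf : {within B, continuous (fun z => `|f z|)}.
  have [C [C0 bf' lf]] := bf; apply: bdlip_within.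
  exists C; split => // [z Bz|z w Bz Bw].
    by rewrite normr_id; exact: bf'.
  by apply: le_trans (lf _ _ Bz Bw); exact: ler_dist_dist.
have [x /set_mem Bx xmin] := EVT_min_rV (ex_intro _ z0 Bz0) cB cf.
have a0 : 0 < `|f x| by rewrite normr_gt0; exact: f0.
have am z : B z -> `|f x| <= `|f z| by move=> Bz; apply: xmin; rewrite inE.
move: (`|f x|) a0 am => a a0 am.
have [C [C0 bf' lf]] := bf.
have ainv z : B z -> `|(f z)^-1| <= a^-1.
  by move=> Bz; rewrite normfV lef_pV2 ?posrE//; [exact: am|rewrite (lt_le_trans a0)// am].
have ai0 : 0 <= a^-1 by rewrite invr_ge0 ltW.
exists (a^-1 + a^-1 * C * a^-1); split.
- by rewrite addr_ge0// !mulr_ge0.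
- by move=> z Bz; apply: (le_trans (ainv z Bz)); rewrite lerDl !mulr_ge0.
- move=> z w Bz Bw.
  have -> : (f z)^-1 - (f w)^-1 = (f z)^-1 * (f w - f z) * (f w)^-1.
    by field; rewrite !f0.
  rewrite !normrM (@le_trans _ _ (a^-1 * (C * `|z - w|) * a^-1))//.
    apply: ler_pM; rewrite ?mulr_ge0//; last exact: ainv.
    by apply: ler_pM => //; [exact: ainv|rewrite distrC; exact: lf].
  rewrite mulrDl; have := mulr_ge0 ai0 (normr_ge0 (z - w)).
  move: `|z - w| => b ab; rewrite -subr_ge0; apply: le_trans ab _.
  by rewrite le_eqVlt; apply/orP; left; apply/eqP; ring.
Qed.

Lemma bdlip_det B p (A : 'rV[R]_m -> 'M[R]_p) :
  (forall i j, bounded_lipschitz B (fun z => A z i j)) ->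
  bounded_lipschitz B (fun z => \det (A z)).
Proof.
move=> bA; apply: bdlip_sum => s; apply: bdlip_mul; first exact: bdlip_cst.
by apply: bdlip_prod => i; exact: bA.
Qed.

(** Cramer's rule: an entry of the inverse is a cofactor over the determinant, and both are
    polynomials in the entries. *)
Lemma bdlip_invmx B p (A : 'rV[R]_m -> 'M[R]_p) : compact B ->
  (forall z, B z -> A z \in unitmx) ->
  (forall i j, bounded_lipschitz B (fun z => A z i j)) ->
  forall i j, bounded_lipschitz B (fun z => invmx (A z) i j).
Proof.
move=> cB uA bA i j.
apply: (@bdlip_ext _ (fun z => (\det (A z))^-1 * cofactor (A z) j i)).
  by move=> z Bz; rewrite /invmx uA// !mxE.
apply: bdlip_mul.
  apply: bdlip_inv => //; first exact: bdlip_det.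
  by move=> z Bz; have := uA z Bz; rewrite unitmxE unitfE.
apply: bdlip_mul; first exact: bdlip_cst.
apply: bdlip_det => k l; apply: bdlip_ext (bA (lift j k) (lift i l)) => z _.
by rewrite !mxE.
Qed.

(** The norm is the maximum over the coordinates, so this closed ball is a cube: compact as a
    product of segments, and clamping onto it coordinate by coordinate does not increase
    distances. *)
Definition box (y0 : 'rV[R]_m) r : set 'rV[R]_m := [set y | `|y - y0| <= r].

Lemma box_compact y0 r : compact (box y0 r).
Proof.
have [r0|r0] := leP 0 r; last first.
  rewrite (_ : box _ _ = set0); first exact: compact0.
  by apply/seteqP; split => // y; rewrite /box/= leNgt (lt_le_trans r0).
rewrite (_ : box y0 r =
    [set v | forall i, `[y0 0 i - r, y0 0 i + r]%classic (v ord0 i)]).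
  apply: (@rV_compact _ _ (fun i => `[y0 0 i - r, y0 0 i + r]%classic)) => i.
  exact: segment_compact.
apply/seteqP; split => v /=.
  move=> vr i; have := le_trans (normr_coord (v - y0) 0 i) vr.
  by rewrite !mxE ler_norml in_itv/= => /andP[? ?]; apply/andP; split; lra.
move=> vr; apply: normr_rV_le => // i; have := vr i.
by rewrite !mxE ler_norml in_itv/= => /andP[? ?]; apply/andP; split; lra.
Qed.

Lemma bdlip_coord y0 r i : bounded_lipschitz (box y0 r) (fun z => z 0 i).
Proof.
exists (`|y0| + `|r| + 1); split; first by rewrite !addr_ge0.
  move=> z zr; apply: (le_trans (normr_coord z 0 i)).
  rewrite -[z](subrK y0) (le_trans (ler_normD _ _))// addrC -addrA lerD2l.
  by apply: (le_trans zr); rewrite (le_trans (ler_norm r))// lerDl.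
move=> z w _ _; have := normr_coord (z - w) 0 i; rewrite !mxE => /le_trans; apply.
by apply: ler_peMl => //; rewrite lerDr addr_ge0.
Qed.

Lemma box_convex y0 r a b s : box y0 r a -> box y0 r b -> 0 <= s <= 1 ->
  box y0 r (a + s *: (b - a)).
Proof.
move=> ar br /andP[s0 s1]; rewrite /box/=.
have -> : a + s *: (b - a) - y0 = (1 - s) *: (a - y0) + s *: (b - y0).
  by apply/rowP => i; rewrite !mxE; ring.
apply: (le_trans (ler_normD _ _)); rewrite !normrZ (ger0_norm s0) ger0_norm ?subr_ge0//.
have -> : r = (1 - s) * r + s * r by ring.
by rewrite lerD// ler_wpM2l// subr_ge0.
Qed.

(** The box is convex, so the mean value theorem applies along segments; it is compact, so the
    partial derivatives are bounded on it. *)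
Lemma bdlip_smooth (O : set 'rV[R]_m) f y0 r : smooth_on O f -> box y0 r `<=` O ->
  bounded_lipschitz (box y0 r) f.
Proof.
move=> sf BO.
have bnd (h : 'rV[R]_m -> R) : smooth_on O h ->
    exists C, 0 <= C /\ forall z, box y0 r z -> `|h z| <= C.
  move=> sh; have ch : {within box y0 r, continuous h}.
    apply: continuous_in_subspaceT => z /set_mem Bz.
    by apply: (smooth_on_cont sh); exact: BO.
  have /compact_bounded[C [_ CP]] := continuous_compact ch (@box_compact y0 r).
  exists (`|C| + 1); split; first exact: addr_ge0.
  move=> z Bz; apply: CP; last by exists z.
  by rewrite (le_lt_trans (ler_norm C))// ltrDl.
have [C0 [C00 C0P]] := bnd f sf.
have /choice[C1 C1P] : forall i, exists C, 0 <= C /\ forall z, box y0 r z ->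
    `|'D_(delta_mx 0 i) f z| <= C.
  by move=> i; apply: bnd; exact: smooth_on_derive.
have C1ge i : 0 <= C1 i by have [] := C1P i.
exists (C0 + \sum_i C1 i); split; first by rewrite addr_ge0// sumr_ge0.
  by move=> z /C0P fz; apply: (le_trans fz); rewrite lerDl sumr_ge0.
move=> z w Bz Bw.
have dseg s : 0 <= s <= 1 -> differentiable f (w + s *: (z - w)).
  by move=> s01; apply: (smooth_on_diff sf); apply: BO; exact: box_convex.
have [s s01] := MVT_line ltr01 dseg.
rewrite scale1r mul1r [w + (z - w)]addrC subrK => ->.
rewrite (diff_sum_delta _ (dseg s s01)) mulrDl.
apply: (@le_trans _ _ ((\sum_i C1 i) * `|z - w|)); last by rewrite lerDr mulr_ge0.
apply: (le_trans (ler_norm_sum _ _ _)); rewrite mulr_suml; apply: ler_sum => i _.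
rewrite -[_ *: _]/(_ * _) normrM mulrC; apply: ler_pM => //; last exact: normr_coord.
by have [_] := C1P i; apply; exact: box_convex.
Qed.

Definition clamp (y0 : 'rV[R]_m) r (z : 'rV[R]_m) : 'rV[R]_m :=
  \row_i Num.max (y0 0 i - r) (Num.min (y0 0 i + r) (z 0 i)).

Lemma clamp_box y0 r z : 0 <= r -> box y0 r (clamp y0 r z).
Proof.
move=> r0; apply: normr_rV_le => // i; rewrite !mxE ler_norml.
rewrite maxEle minEle; case: ifPn; case: ifPn; rewrite -?ltNge => ? ?; lra.
Qed.

Lemma clamp_id y0 r z : box y0 r z -> clamp y0 r z = z.
Proof.
move=> zr; apply/rowP => i; rewrite !mxE.
have := le_trans (normr_coord (z - y0) 0 i) zr; rewrite !mxE ler_norml => /andP[h1 h2].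
rewrite maxEle minEle; case: ifPn; case: ifPn; rewrite -?ltNge => ? ?; lra.
Qed.

Lemma clamp_lipschitz y0 r z w : 0 <= r ->
  `|clamp y0 r z - clamp y0 r w| <= `|z - w|.
Proof.
move=> r0; apply: normr_rV_le => // i; apply: le_trans (normr_coord (z - w) 0 i).
rewrite !mxE; move: (z 0 i) (w 0 i) (y0 0 i) => a b c.
have clipE x y : y = Num.max (c - r) (Num.min (c + r) x) ->
    [\/ x <= c - r /\ y = c - r, c - r <= x <= c + r /\ y = x | c + r <= x /\ y = c + r].
  case: (leP (c + r) x) => h1.
    case: (leP (c - r) (c + r)) => h2 yE; first exact: Or33.
    by exfalso; lra.
  case: (leP (c - r) x) => h2 yE; last by apply: Or31; rewrite ltW.
  by apply: Or32; split => //; apply/andP; split => //; exact: ltW.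
rewrite ler_norml; have := clipE a _ erefl; have := clipE b _ erefl.
move: (Num.max _ _) (Num.max _ _) => A B HB HA.
case: (ger0P (a - b)) => ab; case: HB => -[HB ->]; case: HA => -[HA ->];
  try (case/andP: HA => ? ?); try (case/andP: HB => ? ?); apply/andP; split; lra.
Qed.

End BoundedLipschitz.

Lemma bdlip_comp (R : realType) m p (B : set 'rV[R]_m) (D : set 'rV[R]_p)
    (f : 'rV[R]_p -> R) (phi : 'rV[R]_m -> 'rV[R]_p) :
  bounded_lipschitz D f -> (forall z, B z -> D (phi z)) ->
  (forall z w, `|phi z - phi w| <= `|z - w|) -> bounded_lipschitz B (f \o phi).
Proof.
move=> [C [C0 bf lf]] BD lphi; exists C; split => // [z Bz|z w Bz Bw].
  by apply: bf; exact: BD.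
by apply: (le_trans (lf _ _ (BD _ Bz) (BD _ Bw))); rewrite ler_wpM2l.
Qed.

(** * The Euler-Lagrange equations as a first-order Lipschitz system *)

Section LocalFlow.
Context {R : realType} {n : nat}.
Variables (O : set 'rV[R]_n) (g : 'I_n -> 'I_n -> 'rV[R]_n -> R) (u : 'rV[R]_n -> R).
Hypothesis g_smooth : forall i j, smooth_on O (g i j).
Hypothesis g_sym : forall i j y, O y -> g i j y = g j i y.
Hypothesis g_pos : forall y v, O y -> v != 0 -> 0 < bilin g y v v.
Hypothesis u_smooth : smooth_on O u.

Definition gram x : 'M[R]_n := \matrix_(i, j) g i j x.

Lemma bilin_gram x v w : bilin g x v w = \sum_j (v *m gram x) 0 j * w 0 j.
Proof.
rewrite /bilin exchange_big; apply: eq_bigr => j _; rewrite mxE mulr_suml.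
by apply: eq_bigr => i _; rewrite mxE; ring.
Qed.

(** A nonzero vector killed by the Gram matrix would be null for the form, against [g_pos]. *)
Lemma gram_unit x : O x -> gram x \in unitmx.
Proof.
move=> Ox; rewrite unitmxE unitfE; apply/det0P => -[v v0 vg].
have := g_pos Ox v0; rewrite bilin_gram vg big1 ?ltxx// => j _.
by rewrite mxE mul0r.
Qed.

Lemma bilin_subZl x v a w s :
  bilin g x (v - s *: a) w = bilin g x v w - s * bilin g x a w.
Proof.
rewrite !bilin_gram mulmxBl -scalemxAl mulr_sumr -sumrB.
by apply: eq_bigr => j _; rewrite !mxE; ring.
Qed.

Lemma bilin_ge0 x v : O x -> 0 <= bilin g x v v.
Proof.
move=> Ox; have [->|v0] := eqVneq v 0; last exact/ltW/g_pos.
by rewrite bilin_gram mul0mx big1// => j _; rewrite mxE mul0r.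
Qed.

(* Cauchy-Schwarz for the form [g x], applied to [v] and to the vector
   representing the [k]-th coordinate. *)
Lemma coord_sqr_le x (v : 'rV[R]_n) k : O x ->
  (v 0 k) ^+ 2 <= invmx (gram x) k k * bilin g x v v.
Proof.
move=> Ox; have gu := gram_unit Ox.
pose a : 'rV[R]_n := delta_mx 0 k *m invmx (gram x).
have ag : a *m gram x = delta_mx 0 k by rewrite mulmxKV.
have aw w : bilin g x a w = w 0 k.
  rewrite bilin_gram ag (bigD1 k)//= big1 ?addr0; first by rewrite mxE !eqxx mul1r.
  by move=> j jk; rewrite mxE (negbTE jk) andbF mul0r.
have ak : a 0 k = invmx (gram x) k k by rewrite /a -rowE mxE.
have a0 : a != 0.
  apply/eqP => a0; have := ag; rewrite a0 mul0mx => /matrixP/(_ 0 k).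
  by rewrite !mxE !eqxx => /eqP; rewrite eq_sym oner_eq0.
have akp : 0 < a 0 k by rewrite -aw; exact: g_pos.
have gsym i j : g i j x = g j i x by exact: g_sym.
(* The form is evaluated at the component of [v] orthogonal to [a]. *)
have := bilin_ge0 (v - (v 0 k / a 0 k) *: a) Ox.
rewrite bilin_subZl (bilinC _ _ gsym) bilin_subZl aw (bilinC a _ gsym) bilin_subZl !aw.
rewrite (bilinC v a gsym) aw -ak.
move: (bilin g x v v) (v 0 k) (a 0 k) akp => q b c c0.
have -> : q - b / c * b - b / c * (b - b / c * c) = q - b ^+ 2 / c.
  by field; rewrite gt_eqF.
by rewrite subr_ge0 ler_pdivrMr// mulrC.
Qed.

(** The force minus the part of the derivative of the momentum that is due to the variation of the
    metric along the motion. What remains is twice the metric applied to the acceleration. *)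
Definition generalized_force x (v : 'rV[R]_n) i : R :=
  force g u x v i -
  2 * \sum_j \sum_l v 0 l * 'D_(delta_mx 0 l) (g i j) x * v 0 j.

(** The Euler-Lagrange equations solved for the acceleration. *)
Definition acc x (v : 'rV[R]_n) : 'rV[R]_n :=
  2^-1 *: ((\row_i generalized_force x v i) *m invmx (gram x)).

Lemma is_derive_momentum (q v : R -> 'rV[R]_n) (t : R) i : O (q t) ->
  is_derive t 1 q (v t) -> is_derive t 1 v (acc (q t) (v t)) ->
  is_derive t 1 (fun s => momentum g (q s) (v s) i) (force g u (q t) (v t) i).
Proof.
move=> Oq dq dv.
have dg j : is_derive t 1 (g i j \o q) ('D_(v t) (g i j) (q t)).
  by apply: is_derive_curve dq _; exact: smooth_on_diff (g_smooth i j) Oq.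
have dm j := is_deriveM (dg j) (is_derive_coord 0 j dv).
have ds := is_derive_bigsum (index_enum 'I_n) dm.
apply: (is_derive_eq (is_deriveZ 2 ds)).
rewrite -![_ *: _]/(_ * _) big_split/=.
have -> : \sum_j (g i j \o q) t *: acc (q t) (v t) 0 j =
    2^-1 * generalized_force (q t) (v t) i.
  have -> : 2^-1 * generalized_force (q t) (v t) i = (acc (q t) (v t) *m gram (q t)) 0 i.
    by rewrite /acc -scalemxAl mulmxKV ?gram_unit// !mxE.
  rewrite mxE; apply: eq_bigr => j _; rewrite [gram _ _ _]mxE -[_ *: _]/(_ * _) mulrC/=.
  by rewrite (g_sym i j Oq).
rewrite /generalized_force.
have -> : \sum_j v t 0 j *: 'D_(v t) (g i j) (q t) =
    \sum_j \sum_l v t 0 l * 'D_(delta_mx 0 l) (g i j) (q t) * v t 0 j.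
  apply: eq_bigr => j _; rewrite -[_ *: _]/(_ * _) mulrC.
  rewrite diff_sum_delta ?mulr_suml//; exact: smooth_on_diff (g_smooth i j) Oq.
by field.
Qed.

Variables (y0 : 'rV[R]_n) (r : R).
Hypothesis r0 : 0 < r.
Hypothesis boxO : box y0 r `<=` O.

Lemma bdlip_invgram i j : bounded_lipschitz (box y0 r) (fun x => invmx (gram x) i j).
Proof.
apply: bdlip_invmx; first exact: box_compact.
  by move=> x /boxO; exact: gram_unit.
move=> k l; apply: bdlip_ext (bdlip_smooth (g_smooth k l) boxO) => x _.
by rewrite mxE.
Qed.

(** Cauchy-Schwarz bounds each coordinate through a diagonal entry of the inverse Gram matrix, and
    these entries are bounded on the box. Energy thereby controls speed, uniformly in the
    position. *)
Lemma coercive : exists2 H, 0 < H & forall x (v : 'rV[R]_n), box y0 r x ->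
  `|v| ^+ 2 <= H * bilin g x v v.
Proof.
have /choice[C CP] : forall k, exists C, 0 <= C /\
    forall x, box y0 r x -> `|invmx (gram x) k k| <= C.
  by move=> k; have [C [C0 bC _]] := bdlip_invgram k k; exists C.
have C0 k : 0 <= C k by have [] := CP k.
have S0 : 0 < \sum_k C k + 1 by rewrite ltr_wpDl// sumr_ge0.
exists (\sum_k C k + 1) => // x v xB; have Ox := boxO xB.
have b0 := bilin_ge0 v Ox.
have H0 : 0 <= (\sum_k C k + 1) * bilin g x v v by rewrite mulr_ge0// ltW.
rewrite -(sqr_sqrtr H0) ler_pXn2r ?nnegrE ?sqrtr_ge0//.
apply: normr_rV_le; first exact: sqrtr_ge0.
move=> k; rewrite -(@ler_pXn2r _ 2) ?nnegrE ?sqrtr_ge0// sqr_sqrtr// real_normK ?num_real//.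
apply: (le_trans (coord_sqr_le v k Ox)); apply: ler_wpM2r => //.
have [_ Ck] := CP k; apply: (le_trans (ler_norm _)); apply: (le_trans (Ck _ xB)).
by rewrite (bigD1 k)//= -addrA lerDl addr_ge0// sumr_ge0.
Qed.

Lemma normr_lsubmx_sub (z w : 'rV[R]_(n + n)) : `|lsubmx z - lsubmx w| <= `|z - w|.
Proof.
apply: normr_rV_le => // i; apply: le_trans (normr_coord (z - w) 0 (lshift n i)).
by rewrite !mxE.
Qed.

Lemma normr_rsubmx_sub (z w : 'rV[R]_(n + n)) : `|rsubmx z - rsubmx w| <= `|z - w|.
Proof.
apply: normr_rV_le => // i; apply: le_trans (normr_coord (z - w) 0 (rshift n i)).
by rewrite !mxE.
Qed.

Definition phase_field (z : 'rV[R]_(n + n)) : 'rV[R]_(n + n) :=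
  row_mx (rsubmx z) (acc (lsubmx z) (rsubmx z)).

Let ctr : 'rV[R]_(n + n) := row_mx y0 0.

Lemma box_ctr z : box ctr r z <-> box y0 r (lsubmx z) /\ box 0 r (rsubmx z).
Proof.
rewrite /box/= subr0; split => [zr|[lr rr]].
  split; [apply: le_trans zr|apply: le_trans zr].
    by have := normr_lsubmx_sub z ctr; rewrite row_mxKl.
  by have := normr_rsubmx_sub z ctr; rewrite row_mxKr subr0.
apply: normr_rV_le => [|k]; first exact: ltW.
have -> : (z - ctr) 0 k = z 0 k - ctr 0 k by rewrite !mxE.
case: (split_ordP k) => j ->; rewrite /ctr.
  by rewrite row_mxEl; have := le_trans (normr_coord _ 0 j) lr; rewrite !mxE.
by have := le_trans (normr_coord _ 0 j) rr; rewrite row_mxEr !mxE subr0.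
Qed.

(** The acceleration is polynomial in the velocity, the first derivatives of [g] and [u] and the
    entries of the inverse Gram matrix, each of them bounded and Lipschitz on the box. *)
Lemma bdlip_phase_field k : bounded_lipschitz (box ctr r) (fun z => phase_field z 0 k).
Proof.
have bl f : bounded_lipschitz (box y0 r) f ->
    bounded_lipschitz (box ctr r) (fun z => f (lsubmx z)).
  move=> bf; apply: (@bdlip_comp _ _ _ _ _ f (fun z => lsubmx z) bf).
    by move=> z /box_ctr[].
  exact: normr_lsubmx_sub.
have bv i : bounded_lipschitz (box ctr r) (fun z => (rsubmx z) 0 i).
  by apply: bdlip_ext (bdlip_coord ctr r (rshift n i)) => z _; rewrite mxE.
have bg i j l :
    bounded_lipschitz (box ctr r) (fun z => 'D_(delta_mx 0 l) (g i j) (lsubmx z)).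
  exact: bl (bdlip_smooth (smooth_on_derive _ (g_smooth i j)) boxO).
have bu l : bounded_lipschitz (box ctr r) (fun z => 'D_(delta_mx 0 l) u (lsubmx z)).
  exact: bl (bdlip_smooth (smooth_on_derive _ u_smooth) boxO).
have bf i :
    bounded_lipschitz (box ctr r) (fun z => generalized_force (lsubmx z) (rsubmx z) i).
  rewrite /generalized_force /force /bilin; apply: bdlip_sub.
    apply: bdlip_sub.
      apply: bdlip_sum => j; apply: bdlip_sum => l.
      apply: bdlip_mul; last exact: bv.
      apply: bdlip_mul; last exact: bv.
      exact: bg.
    exact: bu.
  apply: bdlip_mul; first exact: bdlip_cst.
  apply: bdlip_sum => j; apply: bdlip_sum => l.
  apply: bdlip_mul; last exact: bv.
  apply: bdlip_mul; first exact: bv.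
  exact: bg.
case: (split_ordP k) => j ->.
  by apply: bdlip_ext (bv j) => z _; rewrite row_mxEl.
apply: (@bdlip_ext _ _ _ (fun z => 2^-1 *
  \sum_i generalized_force (lsubmx z) (rsubmx z) i * invmx (gram (lsubmx z)) i j)).
  move=> z _; rewrite row_mxEr !mxE; congr (_ * _).
  by apply: eq_bigr => i _; rewrite mxE.
apply: bdlip_mul; first exact: bdlip_cst.
apply: bdlip_sum => i; apply: bdlip_mul; first exact: bf.
exact: (bl _ (bdlip_invgram i j)).
Qed.

(* Clamping both position and velocity to boxes makes the vector field globally
   Lipschitz without changing it inside the boxes. *)
Lemma local_flow v0 : exists q v a : R -> 'rV[R]_n,
  [/\ q 0 = y0, v 0 = v0, continuous q, continuous v & continuous a] /\
  forall t : R, box y0 r (q t) -> box 0 r (v t) ->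
    [/\ is_derive t 1 q (v t), is_derive t 1 v (acc (q t) (v t)) &
        a t = acc (q t) (v t)].
Proof.
have /choice[C CP] : forall k, exists C, 0 <= C /\ forall z w, box ctr r z -> box ctr r w ->
    `|phase_field z 0 k - phase_field w 0 k| <= C * `|z - w|.
  by move=> k; have [C [C0 _ lC]] := bdlip_phase_field k; exists C.
have C0 k : 0 <= C k by have [] := CP k.
pose K := \sum_k C k + 1.
have K0 : 0 < K by rewrite ltr_wpDl// sumr_ge0.
pose F z := phase_field (clamp ctr r z).
have FK z w : `|F z - F w| <= K * `|z - w|.
  apply: (@le_trans _ _ (K * `|clamp ctr r z - clamp ctr r w|)); last first.
    by rewrite ler_pM2l// clamp_lipschitz// ltW.
  apply: normr_rV_le => [|k]; first by rewrite mulr_ge0// ltW.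
  have [_ Ck] := CP k.
  have subE (a b : 'rV[R]_(n + n)) : (a - b) 0 k = a 0 k - b 0 k by rewrite !mxE.
  rewrite subE; have := Ck _ _ (clamp_box ctr z (ltW r0)) (clamp_box ctr w (ltW r0)).
  rewrite -/(F z) -/(F w) => /le_trans; apply; rewrite ler_wpM2r//.
  by rewrite /K (bigD1 k)//= -addrA lerDl addr_ge0// sumr_ge0.
have [z [z0 dz]] := picard_global (row_mx y0 v0) K0 FK.
have cz : continuous z by move=> t; exact: is_derive_continuous (dz t).
have cF : continuous F.
  move=> x; apply/(@cvgrPdist_le _ _ _ (nbhs x)) => e e0.
  have eK : 0 < e / K by rewrite divr_gt0.
  have cx : continuous_at x (@id 'rV[R]_(n + n)) by exact: cvg_id.
  have /(@cvgrPdist_le _ _ _ (nbhs x))/(_ _ eK) {}cx := cx.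
  apply: filterS cx => w /= zw; apply: (le_trans (FK _ _)).
  by rewrite mulrC -ler_pdivlMr.
have contr (A : R -> 'rV[R]_(n + n)) : continuous A -> continuous (fun t => rsubmx (A t)).
  move=> cA t; apply/cvgrPdist_le => e e0.
  have /cvgrPdist_le/(_ _ e0) := cA t; apply: filterS => s /=; apply: le_trans.
  exact: normr_rsubmx_sub.
have contl (A : R -> 'rV[R]_(n + n)) : continuous A -> continuous (fun t => lsubmx (A t)).
  move=> cA t; apply/cvgrPdist_le => e e0.
  have /cvgrPdist_le/(_ _ e0) := cA t; apply: filterS => s /=; apply: le_trans.
  exact: normr_lsubmx_sub.
exists (fun t => lsubmx (z t)), (fun t => rsubmx (z t)), (fun t => rsubmx (F (z t))).
split.
  split; rewrite ?z0 ?row_mxKl ?row_mxKr//; [exact: contl|exact: contr|].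
  by apply: contr => t; apply: continuous_comp; [exact: cz|exact: cF].
move=> t qt vt; have zB : box ctr r (z t) by apply/box_ctr.
have Fz : F (z t) = phase_field (z t) by rewrite /F clamp_id.
have := dz t; rewrite Fz => dzt; split.
- apply: is_derive_mx => i j; rewrite ord1.
  have := is_derive_coord 0 (lshift n j) dzt; rewrite row_mxEl.
  by congr is_derive; apply/funext => s; rewrite mxE.
- apply: is_derive_mx => i j; rewrite ord1.
  have := is_derive_coord 0 (rshift n j) dzt; rewrite row_mxEr.
  by congr is_derive; apply/funext => s; rewrite mxE.
- by rewrite row_mxKr.
Qed.

End LocalFlow.

(** * Escape from the equilibrium *)

Section RealInduction.
Context {R : realType}.

(** The infimum of the failures satisfies [P], and failures cannot accumulate at it from the
    right. *)
Lemma real_induction (P : R -> Prop) (T : R) : P 0 ->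
  (forall s, 0 <= s < T -> P s ->
    exists2 d, 0 < d & forall t, s < t < s + d -> P t) ->
  (forall s, 0 < s <= T -> (forall t, 0 <= t < s -> P t) -> P s) ->
  forall t, 0 <= t <= T -> P t.
Proof.
move=> P0 Pright Pleft t0 t0T; apply: contrapT => nPt0.
pose bad := [set t | 0 <= t <= T /\ ~ P t].
have lb0 : lbound bad 0 by move=> t [/andP[]].
have hi : has_inf bad by split; [exists t0|exists 0].
set s := inf bad.
have s0 : 0 <= s by apply: lb_le_inf => //; exists t0.
have sT : s <= T.
  apply: (@le_trans _ _ t0); last by case/andP: t0T.
  by apply: ge_inf; [exists 0|].
have below t : 0 <= t < s -> P t.
  move=> /andP[t0' ts]; apply: contrapT => nPt.
  have : s <= t.
    apply: ge_inf; first by exists 0.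
    by split => //; rewrite t0' (le_trans (ltW ts)).
  by rewrite leNgt ts.
have Ps : P s.
  have [s_0|s_n0] := eqVneq s 0; first by rewrite s_0.
  by apply: Pleft => //; rewrite lt_neqAle eq_sym s_n0 s0.
have [sT'|sT'] := ltP s T; last first.
  have sTe : s = T by apply/eqP; rewrite eq_le sT sT'.
  apply: nPt0; have [t0s|t0s] := ltP t0 s.
    by apply: below; rewrite t0s andbT; case/andP: t0T.
  have -> : t0 = s by apply/eqP; rewrite eq_le t0s andbT sTe; case/andP: t0T.
  exact: Ps.
have [d d0 Pd] := Pright s (introT andP (conj s0 sT')) Ps.
have [t [/andP[t0' tT] nPt] tsd] := inf_adherent d0 hi.
apply: nPt; have [ts|st|ts] := ltgtP t s; last by rewrite ts.
  by apply: below; rewrite t0' ts.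
by apply: Pd; rewrite st.
Qed.

(** With the slope relaxed to [K + e], the inequality advances to the right by the Dini bound and
    passes to left limits by continuity, so real induction applies; then [e] tends to 0. *)
Lemma lower_dini_le (f : R -> R) (K T : R) :
  (forall s, 0 < s <= T -> f t @[t --> s^'-] --> f s) ->
  (forall s e, 0 <= s < T -> 0 < e -> exists2 d, 0 < d &
    forall t, s < t < s + d -> t <= T -> - (K + e) * (t - s) <= f t - f s) ->
  forall t, 0 <= t <= T -> f 0 - K * t <= f t.
Proof.
move=> cf df t tT.
have /andP[t0 _] := tT.
suff H e : 0 < e -> f 0 - (K + e) * t <= f t.
  apply/ler_addgt0Pr => e e0.
  have e1 : 0 < e / (t + 1) by rewrite divr_gt0// ltr_wpDl.
  have := H _ e1; have : e / (t + 1) * t <= e.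
    have t1 : 0 < t + 1 by rewrite ltr_wpDl.
    by rewrite mulrAC (ler_pdivrMr _ _ t1) (ler_pM2l e0) lerDl.
  by move: (e / (t + 1)) => b bt Ht; rewrite -lerBlDr; apply: le_trans Ht; lra.
move=> e0; move: t tT {t0}.
apply: real_induction; first by rewrite mulr0 subr0.
- move=> s sT Ps; have [d d0 fd] := df s e sT e0.
  have dm : 0 < Num.min d (T - s) by rewrite lt_min d0 subr_gt0; case/andP: sT.
  exists (Num.min d (T - s)) => // t /andP[st].
  rewrite -ltrBlDl lt_min => /andP[td tT].
  have := fd t; rewrite st -ltrBlDl td => /(_ isT) fd'.
  have /fd' : t <= T by lra.
  by lra.
- move=> s /andP[s0 sT] Ps.
  have cs : f t @[t --> s^'-] --> f s.
    by apply: cf; rewrite s0.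
  have cl : f t + (K + e) * t @[t --> s^'-] --> f s + (K + e) * s.
    apply: cvgD => //; apply: cvgM; first exact: cvg_cst.
    by apply: cvg_at_left_filter; exact: cvg_id.
  suff : f 0 <= f s + (K + e) * s by rewrite lerBlDr.
  apply: (cvgr_to_ge cl); near=> t.
  rewrite -lerBlDr; apply: Ps; apply/andP; split.
    by near: t; exact: nbhs_left_ge.
  by near: t; exact: nbhs_left_lt.
Unshelve. all: by end_near. Qed.

Lemma is_derive_right_lower (f : R -> R) (s d e : R) : is_derive s 1 f d -> 0 < e ->
  exists2 r, 0 < r & forall t, s < t < s + r -> (d - e) * (t - s) <= f t - f s.
Proof.
move=> [df dE] e0.
have := df; rewrite /derivable => /cvgP/=.
have /cvg_ex[l fl] := df; have dl : d = l by rewrite -dE; apply/cvg_lim.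
move=> _; rewrite -dl in fl.
move/cvgrPdist_lt : fl => /(_ _ e0) [r /= r0 rP].
exists r => // t /andP[st tr].
have ts0 : 0 < t - s by rewrite subr_gt0.
have := rP (t - s); rewrite /ball_/= sub0r normrN gtr0_norm// ltrBlDl => /(_ tr).
rewrite gt_eqF// => /(_ isT); rewrite [_ *: 1]mulr1 subrK.
rewrite ltr_distlC => /andP[+ _]; rewrite -[_ *: _]/(_ * _) mulrC => h.
have : (d - e) < (f t - f s) / (t - s) by lra.
by rewrite ltr_pdivlMr// => /ltW.
Qed.

(** The mean value theorem needs scalar functions; arguing by coordinates loses nothing in the
    maximum norm. *)
Lemma norm_curve_le n (q v : R -> 'rV[R]_n) (V a b : R) : a <= b -> 0 <= V ->
  (forall t, a <= t <= b -> is_derive t 1 q (v t)) ->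
  (forall t, a <= t <= b -> `|v t| <= V) ->
  `|q b - q a| <= V * (b - a).
Proof.
move=> ab V0 dq vV; apply: normr_rV_le => [|i]; first by rewrite mulr_ge0// subr_ge0.
have dqi t : a <= t <= b -> is_derive t 1 (fun s => q s 0 i) (v t 0 i).
  by move=> tab; apply: is_derive_coord; exact: dq.
have [||c cab E] := @MVT_segment R (fun s => q s 0 i) (fun t => v t 0 i) a b ab.
- by move=> t; rewrite in_itv/= => /andP[at' tb]; apply: dqi; rewrite !ltW.
- by apply: derivable_within_continuous => t; rewrite in_itv/= => /dqi[].
rewrite !mxE E normrM (ger0_norm (_ : 0 <= b - a)) ?subr_ge0// ler_wpM2r ?subr_ge0//.
apply: le_trans (normr_coord _ 0 i) _; apply: vV.
by move: cab; rewrite in_itv.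
Qed.

End RealInduction.

(** * Conservation of energy *)

Section Estimates.
Context {R : realType} {n : nat}.

Lemma sumr_le_const m (f : 'I_m -> R) A : (forall i, f i <= A) ->
  \sum_i f i <= m%:R * A.
Proof.
move=> fA; rewrite mulr_natl -[m in leRHS]card_ord -sumr_const.
by apply: ler_sum => i _.
Qed.

Lemma sum_norm_le (c v : 'I_n -> R) (A B : R) :
  (forall i, `|c i| <= A) -> (forall i, `|v i| <= B) ->
  `|\sum_i c i * v i| <= n%:R * (A * B).
Proof.
move=> cA vB; apply: (le_trans (ler_norm_sum _ _ _)).
by apply: sumr_le_const => i; rewrite normrM; apply: ler_pM.
Qed.

Lemma bilin_norm_le (g : 'I_n -> 'I_n -> 'rV[R]_n -> R) x (v w : 'rV[R]_n) (C : R) :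
  (forall i j, `|g i j x| <= C) ->
  `|bilin g x v w| <= n%:R * (n%:R * (C * (`|v| * `|w|))).
Proof.
move=> gC; apply: (le_trans (ler_norm_sum _ _ _)); apply: sumr_le_const => i.
apply: (le_trans (ler_norm_sum _ _ _)); apply: sumr_le_const => j.
rewrite !normrM -mulrA; apply: ler_pM; rewrite ?mulr_ge0//.
by apply: ler_pM; rewrite ?normr_coord.
Qed.

Lemma energy_derive (O : set 'rV[R]_n) (g : 'I_n -> 'I_n -> 'rV[R]_n -> R)
    (u : 'rV[R]_n -> R) (q v a : R -> 'rV[R]_n) (J : set R) t :
  (forall i j, smooth_on O (g i j)) -> (forall i j y, O y -> g i j y = g j i y) ->
  smooth_on O u -> solution g u O J q v a -> J t ->
  is_derive t 1 (fun s => bilin g (q s) (v s) (v s) + u (q s)) 0.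
Proof.
move=> sg gs su [Oq dq dv _ dm] Jt; have Oqt := Oq _ Jt.
have dqt := dq _ Jt; have dvt := dv _ Jt.
have dg i j : differentiable (g i j) (q t) by exact: smooth_on_diff (sg i j) Oqt.
have du : differentiable u (q t) by exact: smooth_on_diff su Oqt.
have dqd : differentiable q t by case: dqt => /derivable1_diffP.
have db := is_derive_bilin dqd dg dvt dvt.
have dqE : 'D_1 q t = v t by case: dqt.
rewrite dqE in db.
apply: (is_derive_eq (is_deriveD db (is_derive_curve dqt du))).
have FE := force_pairing (v t) (v t) dg du.
(* The power of the force computed twice: [FE] uses the position dependence of the Lagrangian, [EF]
   the Euler-Lagrange equations. Their equality says that the energy has derivative 0. *)
have EF : \sum_i force g u (q t) (v t) i * v t 0 i =
    2 * (bilin (fun i j => 'D_(v t) (g i j)) (q t) (v t) (v t) +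
         bilin g (q t) (v t) (a t)).
  rewrite !bilin_sum -big_split/= mulr_sumr; apply: eq_bigr => i _.
  have dgi j := is_derive_curve dqt (dg i j).
  have ds := is_derive_bigsum (index_enum 'I_n)
    (fun j => is_deriveM (dgi j) (is_derive_coord 0 j dvt)).
  have d2 := is_deriveZ 2 ds.
  have := derive_val (is_derive := dm t i Jt).
  have -> : (fun s => momentum g (q s) (v s) i) =
    2 \*: (fun s => \sum_j (g i j \o q) s * v s 0 j) by [].
  rewrite (@derive_val _ _ _ _ _ _ _ d2) => <-.
  rewrite big_split/=.
  have -> : \sum_j v t 0 j *: 'D_(v t) (g i j) (q t) =
      \sum_j 'D_(v t) (g i j) (q t) * v t 0 j.
    by apply: eq_bigr => j _; rewrite -[_ *: _]/(_ * _) mulrC.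
  have -> : \sum_j (g i j \o q) t *: a t 0 j = \sum_j g i j (q t) * a t 0 j by [].
  by rewrite -[_ *: _]/(_ * _); ring.
have -> : bilin g (q t) (a t) (v t) = bilin g (q t) (v t) (a t).
  by apply: bilinC => i j; exact: gs.
rewrite EF in FE; move: FE.
move: (bilin _ _ (v t) (v t)) (bilin g _ _ _) ('D_(v t) u (q t)) => x y z; lra.
Qed.

Lemma energy_constant (O : set 'rV[R]_n) (g : 'I_n -> 'I_n -> 'rV[R]_n -> R)
    (u : 'rV[R]_n -> R) (q v a : R -> 'rV[R]_n) (J : set R) s t :
  (forall i j, smooth_on O (g i j)) -> (forall i j y, O y -> g i j y = g j i y) ->
  smooth_on O u -> solution g u O J q v a -> is_interval J -> J s -> J t -> s <= t ->
  bilin g (q t) (v t) (v t) + u (q t) = bilin g (q s) (v s) (v s) + u (q s).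
Proof.
move=> sg gs su sol iJ Js Jt st.
have de r : s <= r <= t -> is_derive r 1 (fun s => bilin g (q s) (v s) (v s) + u (q s)) 0.
  move=> rst; apply: (energy_derive sg gs su sol).
  exact: (iJ s t).
have [||c _] := @MVT_segment R (fun s => bilin g (q s) (v s) (v s) + u (q s)) (cst 0) s t st.
- by move=> r; rewrite in_itv/= => /andP[sr rt]; apply: de; rewrite !ltW.
- by apply: derivable_within_continuous => r; rewrite in_itv/= => /de[].
by rewrite mul0r => /eqP; rewrite subr_eq0 => /eqP.
Qed.

End Estimates.

Lemma bdlip_uniform (R : realType) m (I : finType) (B : set 'rV[R]_m)
    (f : I -> 'rV[R]_m -> R) : (forall i, bounded_lipschitz B (f i)) ->
  exists C, 0 <= C /\ forall i,
    (forall z, B z -> `|f i z| <= C) /\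
    (forall z w, B z -> B w -> `|f i z - f i w| <= C * `|z - w|).
Proof.
move=> /choice[C CP]; have C0 i : 0 <= C i by have [] := CP i.
exists (\sum_i C i); split; first exact: sumr_ge0.
have Cle i : C i <= \sum_i C i by rewrite (bigD1 i)//= lerDl sumr_ge0.
move=> i; have [_ bf lf] := CP i; split => [z Bz|z w Bz Bw].
  exact: le_trans (bf _ Bz) _.
by apply: le_trans (lf _ _ Bz Bw) _; rewrite ler_wpM2r.
Qed.

(** * The momentum estimate in a box *)

Section Escape.
Context {R : realType} {n : nat}.
Variables (O : set 'rV[R]_n) (g : 'I_n -> 'I_n -> 'rV[R]_n -> R) (u : 'rV[R]_n -> R).
Hypothesis g_smooth : forall i j, smooth_on O (g i j).
Hypothesis g_sym : forall i j y, O y -> g i j y = g j i y.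
Hypothesis g_pos : forall y v, O y -> v != 0 -> 0 < bilin g y v v.
Hypothesis u_smooth : smooth_on O u.
Hypothesis u_ge0 : forall y, O y -> 0 <= u y.
Variables (y0 : 'rV[R]_n) (r : R).
Hypothesis r0 : 0 < r.
Hypothesis boxO : box y0 r `<=` O.
Variables (Y : 'rV[R]_n -> 'rV[R]_n) (P : 'rV[R]_n -> R).
Hypothesis Y_log : forall x, box y0 r x -> 'D_(Y x) u x = P x * u x.

Section Constants.
Variable C : R.
Hypothesis C0 : 0 < C.
Hypothesis g_le : forall i j x, box y0 r x -> `|g i j x| <= C.
Hypothesis dg_le : forall i j k x, box y0 r x -> `|'D_(delta_mx 0 k) (g i j) x| <= C.
Hypothesis Y_le : forall i x, box y0 r x -> `|Y x 0 i| <= C.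
Hypothesis Y_lip : forall x w, box y0 r x -> box y0 r w -> `|Y x - Y w| <= C * `|x - w|.
Hypothesis P_le : forall x, box y0 r x -> `|P x| <= C.
Hypothesis v_le : forall x (v : 'rV[R]_n), box y0 r x -> `|v| ^+ 2 <= C * bilin g x v v.

Section Trajectory.
Variables (J : set R) (q v a : R -> 'rV[R]_n) (T E : R).
Hypothesis iJ : is_interval J.
Hypothesis JT : forall t, 0 <= t <= T -> J t.
Hypothesis sol : solution g u O J q v a.
Hypothesis q_box : forall t, 0 <= t <= T -> box y0 r (q t).
Hypothesis E_def : E = bilin g (q 0) (v 0) (v 0) + u (q 0).

Lemma energy_trajectory t : 0 <= t <= T ->
  bilin g (q t) (v t) (v t) + u (q t) = E.
Proof.
move=> tT; rewrite E_def; apply: (energy_constant g_smooth g_sym u_smooth sol iJ).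
- by apply: JT; case/andP: tT => t0 tT; rewrite lexx (le_trans t0).
- exact: JT.
- by case/andP: tT.
Qed.

Lemma speed_sqr_le t : 0 <= t <= T -> `|v t| ^+ 2 <= C * E.
Proof.
move=> tT; have qB := q_box tT; have uq := u_ge0 (boxO qB).
apply: (le_trans (v_le (v t) qB)); rewrite ler_pM2l// -(energy_trajectory tT).
by rewrite lerDl.
Qed.

(* Bounds, per unit of energy, the three contributions to the rate of change of
   the momentum along [Y]: the derivative of the metric along [Y], [P * u], and
   the variation of [Y] along the trajectory. *)
Definition drift_rate : R := n%:R * n%:R * n%:R * C ^+ 3 + C + 2 * (n%:R * n%:R) * C ^+ 3.

(* [Y] is only Lipschitz, so the momentum along [Y] need not be differentiable
   and its lower Dini derivative is used instead. *)
Lemma momentum_lower t : 0 <= t <= T ->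
  \sum_i momentum g (q 0) (v 0) i * Y (q 0) 0 i - (drift_rate * E) * t <=
  \sum_i momentum g (q t) (v t) i * Y (q t) 0 i.
Proof.
have [dom dq dv _ dm] := sol.
have cq s : 0 <= s <= T -> {for s, continuous q}.
  by move=> /JT /dq; exact: is_derive_continuous.
have nn0 : (0 : R) <= n%:R by [].
move: t.
apply: (@lower_dini_le _ (fun t => \sum_i momentum g (q t) (v t) i * Y (q t) 0 i)).
  move=> s /andP[s0 sT]; have sT' : 0 <= s <= T by rewrite sT ltW.
  have qB := q_box sT'; have Js := JT sT'.
  apply: cvg_big => [|i _]; first exact: add_continuous.
  apply: cvgM.
    by apply: cvg_at_left_filter; exact: is_derive_continuous (dm s i Js).
  apply/cvgrPdist_le => e e0; have eC : 0 < e / C by rewrite divr_gt0.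
  have qs : q t @[t --> s^'-] --> q s by apply: cvg_at_left_filter; exact: cq.
  have /cvgrPdist_le/(_ _ eC) {}qs := qs.
  near=> t.
  have qtB : box y0 r (q t).
    apply: q_box; apply/andP; split; first by near: t; exact: nbhs_left_ge.
    by apply: le_trans sT; near: t; exact: nbhs_left_le.
  have := normr_coord (Y (q s) - Y (q t)) 0 i; rewrite !mxE => /le_trans; apply.
  apply: (le_trans (Y_lip qB qtB)); rewrite mulrC -ler_pdivlMr//.
  by near: t.
move=> s e /andP[s0 sT] e0.
have sT' : 0 <= s <= T by rewrite s0 ltW.
have qB := q_box sT'; have Js := JT sT'; have Oq := dom _ Js.
(* With [Y] frozen at [q s] the momentum is differentiable at [s]; the error of freezing is bounded
   in [f2]. *)
pose h t := \sum_i momentum g (q t) (v t) i * Y (q s) 0 i.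
have dh : is_derive s 1 h (\sum_i force g u (q s) (v s) i * Y (q s) 0 i).
  apply: is_derive_bigsum => i.
  have H := is_deriveM (dm s i Js) (is_derive_cst (Y (q s) 0 i) s 1).
  by apply: (is_derive_eq H); rewrite -![_ *: _]/(_ * _) mulr0 add0r mulrC.
have [d d0 hd] := is_derive_right_lower dh e0.
exists d => // t /andP[st td] tT.
have tT' : 0 <= t <= T by rewrite (le_trans s0 (ltW st)).
have qtB := q_box tT'.
have := hd t; rewrite st td => /(_ isT) {}hd.
have v2 := speed_sqr_le sT'.
have vt2 := speed_sqr_le tT'.
have E0 : 0 <= C * E by apply: le_trans v2; rewrite exprn_ge0.
have dgd i j : differentiable (g i j) (q s) by exact: smooth_on_diff (g_smooth i j) Oq.
have dud : differentiable u (q s) by exact: smooth_on_diff u_smooth Oq.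
have f1 : - (n%:R * n%:R * n%:R * C ^+ 3 * E + C * E) <=
    \sum_i force g u (q s) (v s) i * Y (q s) 0 i.
  rewrite -(force_pairing (v s) (Y (q s)) dgd dud) (Y_log qB).
  have b1 : `|bilin (fun j k => 'D_(Y (q s)) (g j k)) (q s) (v s) (v s)| <=
      n%:R * n%:R * n%:R * C ^+ 3 * E.
    have DY i j : `|'D_(Y (q s)) (g i j) (q s)| <= n%:R * (C * C).
      rewrite (diff_sum_delta _ (dgd i j)).
      by apply: sum_norm_le => k; [exact: Y_le|exact: dg_le].
    apply: (le_trans (bilin_norm_le _ _ DY)).
    rewrite -expr2 (@le_trans _ _ (n%:R * (n%:R * (n%:R * (C * C) * (C * E)))))//.
      rewrite !ler_wpM2l// ?mulr_ge0 ?(ltW C0)//.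
    by rewrite le_eqVlt; apply/orP; left; apply/eqP; ring.
  (* The kinetic part is nonnegative, so [u] is at most the energy: this is how the weakly
     logarithmic property makes the term of order [E]. *)
  have b2 : `|P (q s) * u (q s)| <= C * E.
    rewrite normrM; have uq := u_ge0 Oq; rewrite (ger0_norm uq).
    apply: ler_pM => //; first exact: P_le.
    by rewrite -(energy_trajectory sT') lerDr; exact: bilin_ge0 g_pos _ _ Oq.
  move: b1 b2; rewrite !ler_norml => /andP[b1 _] /andP[_ b2]; lra.
(* The momentum and the distance covered since [s] each contribute a factor [Num.sqrt (C * E)], so
   the product is again linear in [E]. *)
have f2 : `|\sum_i momentum g (q t) (v t) i * (Y (q t) 0 i - Y (q s) 0 i)| <=
    2 * (n%:R * n%:R) * C ^+ 3 * E * (t - s).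
  have V0 : 0 <= Num.sqrt (C * E) by exact: sqrtr_ge0.
  have vV t' : 0 <= t' <= T -> `|v t'| <= Num.sqrt (C * E).
    move=> t'T; rewrite -(@ler_pXn2r _ 2) ?nnegrE// sqr_sqrtr//.
    exact: speed_sqr_le.
  have sub t' : s <= t' <= t -> 0 <= t' <= T.
    by move=> /andP[h1 h2]; rewrite (le_trans s0 h1) (le_trans h2 tT).
  have qq : `|q t - q s| <= Num.sqrt (C * E) * (t - s).
    apply: (@norm_curve_le _ _ q v) => //; first exact: ltW.
      by move=> t' /sub/JT/dq.
    by move=> t' /sub/vV.
  have m1 i : `|momentum g (q t) (v t) i| <= 2 * (n%:R * (C * Num.sqrt (C * E))).
    rewrite /momentum normrM ger0_norm// ler_pM2l//.
    apply: sum_norm_le => j; first exact: g_le.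
    exact: le_trans (normr_coord _ _ _) (vV _ tT').
  have y1 i : `|Y (q t) 0 i - Y (q s) 0 i| <= C * (Num.sqrt (C * E) * (t - s)).
    have := normr_coord (Y (q t) - Y (q s)) 0 i; rewrite !mxE => /le_trans; apply.
    by apply: (le_trans (Y_lip qtB qB)); rewrite ler_pM2l.
  apply: (le_trans (sum_norm_le m1 y1)).
  have := sqr_sqrtr E0; move: (Num.sqrt (C * E)) => V VE.
  have -> : n%:R * (2 * (n%:R * (C * V)) * (C * (V * (t - s)))) =
     2 * (n%:R * n%:R) * C ^+ 2 * V ^+ 2 * (t - s) :> R by ring.
  by rewrite VE le_eqVlt; apply/orP; left; apply/eqP; ring.
have -> : \sum_i momentum g (q t) (v t) i * Y (q t) 0 i -
    \sum_i momentum g (q s) (v s) i * Y (q s) 0 i =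
   (h t - h s) + \sum_i momentum g (q t) (v t) i * (Y (q t) 0 i - Y (q s) 0 i).
  rewrite /h -!sumrB -big_split/=; apply: eq_bigr => i _; ring.
have ts0 : 0 <= t - s by rewrite subr_ge0 ltW.
move: f2; rewrite ler_norml => /andP[f2 _].
have f3 := ler_wpM2r ts0 f1.
rewrite /drift_rate; move: hd f2 f3.
move: (\sum_i _) (\sum_i _) (h t - h s) (C ^+ 3) => A B D C3 hA hB hC; nra.
Unshelve. all: by end_near. Qed.

End Trajectory.

Hypothesis gY_lip : forall j x w, box y0 r x -> box y0 r w ->
  `|\sum_i g i j x * Y x 0 i - \sum_i g i j w * Y w 0 i| <= C * `|x - w|.
Hypothesis uy0 : u y0 = 0.
Hypothesis Yy0 : Y y0 != 0.

Local Notation kap := (bilin g y0 (Y y0) (Y y0)).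

Lemma box_center : box y0 r y0.
Proof. by rewrite /box/= subrr normr0 ltW. Qed.

Lemma kap_gt0 : 0 < kap.
Proof. by apply: g_pos => //; exact/boxO/box_center. Qed.

Lemma drift_rate_gt0 : 0 < drift_rate.
Proof.
have C3 : 0 <= C ^+ 3 by rewrite exprn_ge0// ltW.
have n0 : 0 <= (n%:R : R) by [].
rewrite /drift_rate -addrA; apply: ltr_wpDl; first by do 3 apply: mulr_ge0 => //.
by apply: ltr_wpDr => //; do 3 apply: mulr_ge0 => //.
Qed.

Lemma bilin_sum_r x (v w : 'rV[R]_n) :
  bilin g x v w = \sum_j (\sum_i g i j x * v 0 i) * w 0 j.
Proof.
by rewrite /bilin exchange_big; apply: eq_bigr => j _; rewrite mulr_suml.
Qed.

Lemma no_trapped_trajectory (J : set R) (q v a : R -> 'rV[R]_n) (e rho : R) :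
  0 < e -> 0 <= rho <= r ->
  n%:R * (C * rho * Num.sqrt (C * kap)) <= kap / 4 ->
  n%:R * (n%:R * (C * (`|Y y0| * rho))) < kap / (4 * drift_rate) ->
  is_interval J -> (forall t, 0 <= t <= (2 * drift_rate * e)^-1 -> J t) ->
  solution g u O J q v a -> q 0 = y0 -> v 0 = e *: Y y0 ->
  ~ (forall t, 0 <= t <= (2 * drift_rate * e)^-1 -> `|q t - y0| <= rho).
Proof.
move=> e0 /andP[rho0 rhor] hrho1 hrho2 iJ JT sol q0 v0 trapped.
have K0 := drift_rate_gt0; have k0 := kap_gt0.
set T := (2 * drift_rate * e)^-1 in JT trapped.
have T0 : 0 < T by rewrite invr_gt0 !mulr_gt0.
have qB t : 0 <= t <= T -> box y0 r (q t).
  by move=> /trapped h; exact: le_trans h rhor.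
have E_def : e ^+ 2 * kap = bilin g (q 0) (v 0) (v 0) + u (q 0).
  rewrite q0 v0 uy0 addr0 /bilin mulr_sumr; apply: eq_bigr => i _.
  by rewrite mulr_sumr; apply: eq_bigr => j _; rewrite !mxE; ring.
have low t (tT : 0 <= t <= T) := momentum_lower iJ JT sol qB E_def tT.
have spd t (tT : 0 <= t <= T) := speed_sqr_le iJ JT sol qB E_def tT.
have Ck0 : 0 <= C * kap by rewrite mulr_ge0// ltW.
have vV t : 0 <= t <= T -> `|v t| <= e * Num.sqrt (C * kap).
  move=> /spd h; rewrite -(@ler_pXn2r _ 2) ?nnegrE ?mulr_ge0 ?sqrtr_ge0 ?(ltW e0)//.
  by rewrite exprMn sqr_sqrtr// mulrCA.
(* Progress is measured by pairing the displacement with [Y y0] in the metric at [y0]. *)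
pose f t := \sum_j (\sum_i g i j y0 * Y y0 0 i) * (q t 0 j - y0 0 j).
pose df t := \sum_j (\sum_i g i j y0 * Y y0 0 i) * v t 0 j.
have dfP t : 0 <= t <= T -> is_derive t 1 f (df t).
  move=> /JT Jt; apply: is_derive_bigsum => j.
  have dq := is_derive_coord 0 j (sol_dq sol Jt).
  have H := is_deriveZ (\sum_i g i j y0 * Y y0 0 i)
    (is_deriveB dq (is_derive_cst (y0 0 j) t 1)).
  by apply: (is_derive_eq H); rewrite subr0.
have [||c cT fE] := @MVT_segment R f df 0 T (ltW T0).
- by move=> t; rewrite in_itv/= => /andP[t0 tT]; apply: dfP; rewrite !ltW.
- by apply: derivable_within_continuous => t; rewrite in_itv/= => /dfP[].
have {}cT : 0 <= c <= T by move: cT; rewrite in_itv.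
have f0 : f 0 = 0.
  by rewrite /f q0 big1// => j _; rewrite subrr mulr0.
have fT : `|f T| < kap / (4 * drift_rate).
  apply: le_lt_trans hrho2.
  have -> : f T = bilin g y0 (Y y0) (q T - y0).
    by rewrite bilin_sum_r; apply: eq_bigr => j _; rewrite !mxE.
  apply: (le_trans (bilin_norm_le _ _ (fun i j => g_le i j box_center))).
  rewrite !ler_wpM2l ?(ltW C0)//; apply: trapped.
  by rewrite lexx ltW.
have dfc : e * kap / 2 <= df c.
  have lowc := low c cT.
  have m0 : \sum_i momentum g (q 0) (v 0) i * Y (q 0) 0 i = 2 * e * kap.
    rewrite -momentum_pairing q0 v0 -mulrA; congr (_ * _).
    rewrite /bilin mulr_sumr; apply: eq_bigr => i _.
    by rewrite mulr_sumr; apply: eq_bigr => j _; rewrite !mxE; ring.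
  have mc : \sum_i momentum g (q c) (v c) i * Y (q c) 0 i =
      2 * \sum_j (\sum_i g i j (q c) * Y (q c) 0 i) * v c 0 j.
    by rewrite -momentum_pairing bilin_sum_r.
  have diff : `|\sum_j (\sum_i g i j (q c) * Y (q c) 0 i -
      \sum_i g i j y0 * Y y0 0 i) * v c 0 j| <= e * (kap / 4).
    have h1 j : `|\sum_i g i j (q c) * Y (q c) 0 i - \sum_i g i j y0 * Y y0 0 i|
        <= C * rho.
      apply: (le_trans (gY_lip j (qB _ cT) box_center)).
      by rewrite ler_pM2l// trapped.
    have h2 j : `|v c 0 j| <= e * Num.sqrt (C * kap).
      exact: le_trans (normr_coord _ _ _) (vV _ cT).
    apply: (le_trans (sum_norm_le h1 h2)).
    rewrite [C * rho * _]mulrCA [leLHS]mulrCA ler_pM2l//.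
  have Kc : drift_rate * (e ^+ 2 * kap) * c <= e * kap / 2.
    case/andP: cT => _ cT.
    rewrite (@le_trans _ _ (drift_rate * (e ^+ 2 * kap) * T))//.
      by rewrite ler_wpM2l// !mulr_ge0// ?ltW// exprn_gt0.
    rewrite /T le_eqVlt; apply/orP; left; apply/eqP.
    by field; rewrite !gt_eqF.
  have dE : \sum_j (\sum_i g i j (q c) * Y (q c) 0 i -
      \sum_i g i j y0 * Y y0 0 i) * v c 0 j =
     \sum_j (\sum_i g i j (q c) * Y (q c) 0 i) * v c 0 j - df c.
    by rewrite /df -sumrB; apply: eq_bigr => j _; rewrite mulrBl.
  move: diff; rewrite dE ler_norml => /andP[_ diff].
  rewrite m0 mc in lowc; move: lowc diff Kc.
  move: (drift_rate * _ * c) (df c) (\sum_j _) => A B D; nra.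
have : e * kap / 2 * T <= f T.
  by rewrite -[f T]subr0 -f0 fE subr0 ler_wpM2r// ltW.
have -> : e * kap / 2 * T = kap / (4 * drift_rate).
  by rewrite /T; field; rewrite !gt_eqF.
by rewrite leNgt (le_lt_trans (ler_norm _) fT).
Qed.

End Constants.
End Escape.

(** * Existence of escaping solutions in a chart *)

Section LocalEscape.
Context {R : realType} {n : nat}.
Variables (O : set 'rV[R]_n) (g : 'I_n -> 'I_n -> 'rV[R]_n -> R) (u : 'rV[R]_n -> R).
Hypothesis g_smooth : forall i j, smooth_on O (g i j).
Hypothesis g_sym : forall i j y, O y -> g i j y = g j i y.
Hypothesis g_pos : forall y v, O y -> v != 0 -> 0 < bilin g y v v.
Hypothesis u_smooth : smooth_on O u.
Hypothesis u_ge0 : forall y, O y -> 0 <= u y.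
Variables (y0 : 'rV[R]_n) (r : R).
Hypothesis r0 : 0 < r.
Hypothesis boxO : box y0 r `<=` O.

Lemma solution_in_box (J : set R) (q v a : R -> 'rV[R]_n) :
  continuous a ->
  (forall t : R, box y0 r (q t) -> box 0 r (v t) ->
    [/\ is_derive t 1 q (v t), is_derive t 1 v (acc g u (q t) (v t)) &
        a t = acc g u (q t) (v t)]) ->
  (forall t, J t -> `|q t - y0| < r /\ `|v t| < r) -> solution g u O J q v a.
Proof.
move=> ca flow good.
have qB t : J t -> box y0 r (q t) by move=> /good[/ltW].
have vB t : J t -> box 0 r (v t) by move=> /good[_ /ltW]; rewrite /box/= subr0.
split => [t Jt|t Jt|t Jt|t Jt|t i Jt].
- exact/boxO/qB.
- by have [] := flow t (qB _ Jt) (vB _ Jt).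
- by have [_ + ->] := flow t (qB _ Jt) (vB _ Jt).
- exact: ca.
- have [dq dv _] := flow t (qB _ Jt) (vB _ Jt).
  by apply: (is_derive_momentum g_smooth g_sym g_pos) => //; exact/boxO/qB.
Qed.

Lemma exists_open_good (q v : R -> 'rV[R]_n) s : continuous q -> continuous v ->
  `|q s - y0| < r -> `|v s| < r ->
  exists2 d, 0 < d & forall t, `|t - s| < d -> `|q t - y0| < r /\ `|v t| < r.
Proof.
move=> cq cv qs vs.
have c1 : `|q t - y0| @[t --> s] --> `|q s - y0|.
  by apply: cvg_norm; apply: cvgB; [exact: cq|exact: cvg_cst].
have c2 : `|v t| @[t --> s] --> `|v s| by apply: cvg_norm; exact: cv.
have [d /= d0 dP] := filterI (cvgr_lt _ c1 _ qs) (cvgr_lt _ c2 _ vs).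
by exists d => // t td; apply: dP; rewrite /= distrC.
Qed.

Variables (Y : 'rV[R]_n -> 'rV[R]_n) (P : 'rV[R]_n -> R).
Hypothesis Y_log : forall x, box y0 r x -> 'D_(Y x) u x = P x * u x.
Hypothesis Y_lip : exists L, forall x w, box y0 r x -> box y0 r w ->
  `|Y x - Y w| <= L * `|x - w|.
Hypothesis P_bnd : exists C, forall x, box y0 r x -> `|P x| <= C.
Hypothesis uy0 : u y0 = 0.
Hypothesis Yy0 : Y y0 != 0.

Lemma bdlip_field i : bounded_lipschitz (box y0 r) (fun x => Y x 0 i).
Proof.
have [L LP] := Y_lip; have c0 := box_center y0 r0.
have LP' x w : box y0 r x -> box y0 r w -> `|Y x 0 i - Y w 0 i| <= `|L| * `|x - w|.
  move=> xB wB; have := normr_coord (Y x - Y w) 0 i; rewrite !mxE => /le_trans; apply.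
  by apply: (le_trans (LP _ _ xB wB)); rewrite ler_wpM2r// ler_norm.
exists (`|L| + (`|Y y0 0 i| + `|L| * r)); split.
- by rewrite !addr_ge0// mulr_ge0// ltW.
- move=> x xB; rewrite -[Y x 0 i](subrK (Y y0 0 i)) (le_trans (ler_normD _ _))//.
  rewrite addrC -[leLHS]add0r; apply: lerD => //; apply: lerD => //.
  by apply: (le_trans (LP' _ _ xB c0)); rewrite ler_wpM2l.
- move=> x w xB wB; apply: (le_trans (LP' _ _ xB wB)); rewrite ler_wpM2r// lerDl.
  by rewrite addr_ge0// mulr_ge0// ltW.
Qed.

Theorem local_escape : exists2 rho, 0 < rho & forall d, 0 < d ->
  exists2 v0 : 'rV[R]_n, `|v0| < d &
  exists (J : set R) (q v a : R -> 'rV[R]_n),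
    [/\ open J, is_interval J, J 0, q 0 = y0 & v 0 = v0] /\
    solution g u O J q v a /\ exists t, [/\ J t, 0 <= t & rho <= `|q t - y0|].
Proof.
have [C1 [C10 C1P]] := @bdlip_uniform _ _ ('I_n * 'I_n)%type _ _
  (fun ij => bdlip_smooth (g_smooth ij.1 ij.2) boxO).
have [C2 [C20 C2P]] := @bdlip_uniform _ _ ('I_n * 'I_n * 'I_n)%type _ _
  (fun ijk => bdlip_smooth (smooth_on_derive (delta_mx 0 ijk.2)
     (g_smooth ijk.1.1 ijk.1.2)) boxO).
have [C3 [C30 C3P]] := bdlip_uniform bdlip_field.
have bgY j : bounded_lipschitz (box y0 r) (fun x => \sum_i g i j x * Y x 0 i).
  apply: bdlip_sum => i; apply: bdlip_mul; last exact: bdlip_field.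
  exact: bdlip_smooth (g_smooth i j) boxO.
have [C4 [C40 C4P]] := bdlip_uniform bgY.
have [H H0 HP] := coercive g_smooth g_sym g_pos boxO.
have [L LP] := Y_lip; have [CP CPP] := P_bnd.
pose C := C1 + C2 + C3 + C4 + H + `|L| + `|CP|.
have C1C : C1 <= C by rewrite /C; have := normr_ge0 L; have := normr_ge0 CP; lra.
have C2C : C2 <= C by rewrite /C; have := normr_ge0 L; have := normr_ge0 CP; lra.
have C3C : C3 <= C by rewrite /C; have := normr_ge0 L; have := normr_ge0 CP; lra.
have C4C : C4 <= C by rewrite /C; have := normr_ge0 L; have := normr_ge0 CP; lra.
have HC : H <= C by rewrite /C; have := normr_ge0 L; have := normr_ge0 CP; lra.
have LC : L <= C.
  by rewrite /C; have := normr_ge0 CP; have := ler_norm L; lra.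
have CPC : CP <= C.
  by rewrite /C; have := normr_ge0 L; have := ler_norm CP; lra.
have C0 : 0 < C by exact: lt_le_trans H0 HC.
clearbody C.
have g_le i j x : box y0 r x -> `|g i j x| <= C.
  by move=> xB; have [b _] := C1P (i, j); exact: le_trans (b _ xB) C1C.
have dg_le i j k x : box y0 r x -> `|'D_(delta_mx 0 k) (g i j) x| <= C.
  by move=> xB; have [b _] := C2P (i, j, k); exact: le_trans (b _ xB) C2C.
have Y_le i x : box y0 r x -> `|Y x 0 i| <= C.
  by move=> xB; have [b _] := C3P i; exact: le_trans (b _ xB) C3C.
have Y_lip' x w : box y0 r x -> box y0 r w -> `|Y x - Y w| <= C * `|x - w|.
  by move=> xB wB; apply: (le_trans (LP _ _ xB wB)); rewrite ler_wpM2r.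
have P_le x : box y0 r x -> `|P x| <= C by move=> /CPP h; exact: le_trans h CPC.
have v_le x (v : 'rV[R]_n) : box y0 r x -> `|v| ^+ 2 <= C * bilin g x v v.
  move=> xB; apply: (le_trans (HP x v xB)); rewrite ler_wpM2r//.
  by apply: (bilin_ge0 g_pos); exact: boxO.
have gY_lip j x w : box y0 r x -> box y0 r w ->
    `|\sum_i g i j x * Y x 0 i - \sum_i g i j w * Y w 0 i| <= C * `|x - w|.
  move=> xB wB; have [_ l] := C4P j; apply: (le_trans (l _ _ xB wB)).
  by rewrite ler_wpM2r.
have k0 := kap_gt0 g_pos r0 boxO Yy0.
have K0 : 0 < drift_rate (n := n) C := drift_rate_gt0 C0.
set kap := bilin g y0 (Y y0) (Y y0) in k0.
set W := Num.sqrt (C * kap).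
have W0 : 0 <= W by exact: sqrtr_ge0.
have n0 : (0 : R) <= n%:R by [].
pose A := n%:R * (C * W) + 1.
have A0 : 0 < A by rewrite ltr_wpDl// !mulr_ge0// ltW.
pose B := n%:R * (n%:R * (C * `|Y y0|)) + 1.
have B0 : 0 < B by rewrite ltr_wpDl// !mulr_ge0// ltW.
(* The first entry keeps [rho] below [r]; the others give the two conditions of
   [no_trapped_trajectory], with 8 in place of 4 to make the second one strict. *)
pose rho := Num.min (r / 2) (Num.min (kap / 4 / A) (kap / (8 * drift_rate (n := n) C) / B)).
have rho0 : 0 < rho by rewrite !lt_min !divr_gt0// mulr_gt0.
have rho1 : rho < r.
  apply: (@le_lt_trans _ _ (r / 2)); first by rewrite ge_min lexx.
  by rewrite ltr_pdivrMr// ltr_pMr// ltr1n.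
have rhoA : n%:R * (C * rho * W) <= kap / 4.
  have : rho <= kap / 4 / A by rewrite !ge_min lexx orbT.
  rewrite ler_pdivlMr//; apply: le_trans.
  have -> : n%:R * (C * rho * W) = rho * (n%:R * (C * W)) by ring.
  by rewrite ler_pM2l// lerDl.
have rhoB : n%:R * (n%:R * (C * (`|Y y0| * rho))) < kap / (4 * drift_rate (n := n) C).
  have : rho <= kap / (8 * drift_rate (n := n) C) / B by rewrite !ge_min lexx !orbT.
  rewrite ler_pdivlMr// => h; apply: (@le_lt_trans _ _ (kap / (8 * drift_rate (n := n) C))).
    apply: le_trans h.
    have -> : n%:R * (n%:R * (C * (`|Y y0| * rho))) =
      rho * (n%:R * (n%:R * (C * `|Y y0|))) by ring.
    by rewrite ler_pM2l// lerDl.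
  rewrite ltr_pM2l// ltf_pV2 ?posrE ?mulr_gt0//.
  by rewrite ltr_pM2r//; lra.
clearbody rho.
exists rho => // d d0.
pose N := `|Y y0| + W + 1.
have N0 : 0 < N by rewrite ltr_wpDl// addr_ge0.
(* Then [e * N] is half of the minimum of [d] and [r]: the initial speed is below [d], and the bound
   [e * W] that the energy puts on the speed is below [r]. *)
pose e := Num.min d r / (2 * N).
have m0 : 0 < Num.min d r by rewrite lt_min d0.
have e0 : 0 < e by rewrite divr_gt0// mulr_gt0.
have eN : e * N < Num.min d r.
  have -> : e * N = Num.min d r / 2 by rewrite /e; field; rewrite gt_eqF.
  by lra.
have [eNd eNr] : e * N < d /\ e * N < r by apply/andP; rewrite -lt_min.
have eY : e * `|Y y0| <= e * N by rewrite ler_pM2l// /N -addrA lerDl addr_ge0.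
have eW : e * W < r.
  by apply: le_lt_trans eNr; rewrite ler_pM2l// /N addrAC lerDr addr_ge0.
have neY : `|e *: Y y0| = e * `|Y y0| by rewrite normrZ gtr0_norm.
clearbody e.
exists (e *: Y y0); first by rewrite neY (le_lt_trans eY).
apply: contrapT => noescape.
have [q [v [a [[q0 v0 cq cv ca] flow]]]] :=
  local_flow g_smooth g_pos u_smooth r0 boxO (e *: Y y0).
have stay (J : set R) : open J -> is_interval J -> J 0 ->
    (forall t, J t -> `|q t - y0| < r /\ `|v t| < r) ->
    forall t, J t -> 0 <= t -> `|q t - y0| < rho.
  move=> oJ iJ J0 good t Jt t0; rewrite ltNge; apply/negP => far; apply: noescape.
  exists J, q, v, a; split => //; split; first exact: solution_in_box.
  by exists t.
have good0 : `|q 0 - y0| < r /\ `|v 0| < r.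
  rewrite q0 v0 subrr normr0 neY; split => //; exact: le_lt_trans eY eNr.
(* Motions live on open intervals containing 0, so the curve must stay in the box slightly before
   time 0 as well. *)
have [d1 d10 near0] : exists2 d, 0 < d & forall t, `|t - 0| < d ->
    `|q t - y0| < r /\ `|v t| < r.
  by apply: exists_open_good => //; case: good0.
have Jgood (s : R) : (forall t, 0 <= t < s -> `|q t - y0| < r /\ `|v t| < r) ->
    forall t, `]-d1, s[%classic t -> `|q t - y0| < r /\ `|v t| < r.
  move=> gs t; rewrite /= in_itv/= => /andP[td ts].
  have [t0|t0] := leP 0 t; first by apply: gs; rewrite t0.
  by apply: near0; rewrite subr0 ltr0_norm// ltrNl.
have J0 (s : R) : 0 < s -> `]-d1, s[%classic 0.
  by move=> s0; rewrite /= in_itv/= s0 oppr_lt0 d10.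
have oJ s : open (`]-d1, s[%classic : set R) by exact: interval_open.
have iJ s : is_interval (`]-d1, s[%classic : set R) by exact: interval_is_interval.
have E_def : e ^+ 2 * kap = bilin g (q 0) (v 0) (v 0) + u (q 0).
  rewrite q0 v0 uy0 addr0 /kap /bilin mulr_sumr; apply: eq_bigr => i _.
  by rewrite mulr_sumr; apply: eq_bigr => j _; rewrite !mxE; ring.
(* Before [s] the position is within [rho] by [stay] and the speed at most [e * W] by the energy.
   Both bounds are below [r], so the strict inequalities survive in the limit at [s]. *)
have good T : 0 <= T -> forall t, 0 <= t <= T -> `|q t - y0| < r /\ `|v t| < r.
  move=> T0; apply: real_induction => //.
    move=> s _ [qs vs]; have [d2 d20 near2] := exists_open_good cq cv qs vs.
    exists d2 => // t /andP[st td]; apply: near2.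
    by rewrite gtr0_norm ?subr_gt0// ltrBlDl.
  move=> s /andP[s0 _] gs.
  have gJ := Jgood s gs.
  have sol : solution g u O `]-d1, s[%classic q v a by exact: solution_in_box.
  have qrho t : 0 <= t < s -> `|q t - y0| < rho.
    move=> /andP[t0 ts]; apply: (stay _ (oJ s) (iJ s) (J0 s s0) gJ) => //.
    by rewrite /= in_itv/= ts (lt_le_trans _ t0)// oppr_lt0.
  have vW t : 0 <= t < s -> `|v t| <= e * W.
    move=> /andP[t0 ts].
    have sub t' : 0 <= t' <= t -> 0 <= t' < s.
      by move=> /andP[-> h]; exact: le_lt_trans h ts.
    have Jt t' : 0 <= t' <= t -> `]-d1, s[%classic t'.
      move=> /sub/andP[t'0 t's].
      by rewrite /= in_itv/= t's (lt_le_trans _ t'0)// oppr_lt0.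
    have qB t' : 0 <= t' <= t -> box y0 r (q t').
      by move=> /sub/qrho h; exact/ltW/(lt_trans h).
    have tt : 0 <= t <= t by rewrite t0 lexx.
    have := speed_sqr_le g_smooth g_sym u_smooth u_ge0 boxO C0 v_le (iJ s) Jt sol qB E_def tt.
    have Ck0 : 0 <= C * kap by rewrite mulr_ge0// ltW.
    move=> h; rewrite -(@ler_pXn2r _ 2) ?nnegrE ?mulr_ge0 ?sqrtr_ge0 ?(ltW e0)//.
    by rewrite exprMn sqr_sqrtr// mulrCA.
  have c1 : `|q t - y0| @[t --> s^'-] --> `|q s - y0|.
    apply: cvg_at_left_filter.
    by apply: cvg_norm; apply: cvgB; [exact: cq|exact: cvg_cst].
  have c2 : `|v t| @[t --> s^'-] --> `|v s|.
    by apply: cvg_at_left_filter; apply: cvg_norm; exact: cv.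
  split.
    apply: le_lt_trans rho1; apply: (cvgr_to_le c1); near=> t; apply: ltW; apply: qrho.
    by apply/andP; split; near: t; [exact: nbhs_left_ge|exact: nbhs_left_lt].
  apply: le_lt_trans eW; apply: (cvgr_to_le c2); near=> t; apply: vW.
  by apply/andP; split; near: t; [exact: nbhs_left_ge|exact: nbhs_left_lt].
set T := (2 * drift_rate (n := n) C * e)^-1.
have T0 : 0 < T by rewrite invr_gt0 !mulr_gt0.
(* Running up to [T + 1] puts [T] inside the open interval of times. *)
have T10 : 0 < T + 1 by rewrite addr_gt0.
have gT : forall t, 0 <= t < T + 1 -> `|q t - y0| < r /\ `|v t| < r.
  move=> t /andP[t0 tT]; apply: (good _ (ltW T10)); rewrite t0; exact: ltW.
have gJ := Jgood _ gT.
have JT t : 0 <= t <= T -> `]-d1, (T + 1)[%classic t.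
  move=> /andP[t0 tT]; rewrite /= in_itv/= (lt_le_trans _ t0) ?oppr_lt0//=.
  by rewrite (le_lt_trans tT)// ltrDl.
have rho_r : 0 <= rho <= r by rewrite !ltW.
have sol : solution g u O `]-d1, (T + 1)[%classic q v a by exact: solution_in_box.
apply: (no_trapped_trajectory g_smooth g_sym g_pos u_smooth u_ge0 r0 boxO Y_log C0
  g_le dg_le Y_le Y_lip' P_le v_le gY_lip uy0 Yy0 e0 rho_r rhoA rhoB (iJ _) JT sol q0 v0).
move=> t tT; apply: ltW; apply: (stay _ (oJ _) (iJ _) (J0 _ T10) gJ); first exact: JT.
by case/andP: tT.
Unshelve. all: by end_near. Qed.

End LocalEscape.

(** * Conclusion *)

Lemma derive_ge0_at_min (R : realType) (E : normedModType R) (f : E -> R) x e :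
  differentiable f x -> (\forall y \near x, f x <= f y) -> 0 <= 'D_e f x.
Proof.
move=> df fmin.
have df0 : differentiable f (x + (0 : R) *: e) by rewrite scale0r addr0.
have dl := is_derive_line df0; rewrite scale0r addr0 in dl.
have near0 : \forall s \near (0 : R), f x <= f (x + s *: e).
  have cl : {for 0, continuous (fun s : R => x + s *: e)}.
    apply: continuousD; first exact: cst_continuous.
    exact: scalel_continuous.
  have := cl (fun y => f x <= f y); apply; rewrite /= scale0r addr0; exact: fmin.
have [d0 /= d00 dP] := near0.
rewrite leNgt; apply/negP => Dlt.
have e0 : 0 < - 'D_e f x / 2 by rewrite divr_gt0// oppr_gt0.
have [d1 d10 lo] := is_derive_right_lower (is_deriveN dl) e0.
pose t := Num.min d0 d1 / 2.
have m0 : 0 < Num.min d0 d1 by rewrite lt_min d00.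
have t0 : 0 < t by rewrite divr_gt0.
have tm : t < Num.min d0 d1 by rewrite ltr_pdivrMr// ltr_pMr// ltr1n.
have [td0 td1] : t < d0 /\ t < d1 by apply/andP; rewrite -lt_min.
have := lo t; rewrite add0r t0 td1 => /(_ isT).
rewrite subr0 !fctE scale0r addr0.
have := dP t; rewrite /= sub0r normrN gtr0_norm// => /(_ td0).
move: ('D_e f x) (f x) (f (x + t *: e)) Dlt => D a b D0 ab.
by have := mulr_gt0 t0 (_ : 0 < - D); rewrite oppr_gt0 => /(_ D0); nra.
Qed.

Lemma derive_eq0_at_min (R : realType) (E : normedModType R) (f : E -> R) x e :
  differentiable f x -> (\forall y \near x, f x <= f y) -> 'D_e f x = 0.
Proof.
move=> df fmin; apply/eqP; rewrite eq_le (derive_ge0_at_min e df fmin) andbT.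
have := derive_ge0_at_min (- e) df fmin.
by rewrite !(deriveE _ df) linearN oppr_ge0.
Qed.

Section Main.
Context {R : realType} {n : nat} {M : smooth_manifold R n}.
Variables (Q : forall x : M, tangent x -> R) (U : M -> R) (p : M).
Hypothesis Q_smooth : smooth_quadratic_section Q.
Hypothesis Q_pos : positive_definite Q.
Hypothesis U_smooth : smooth_function U.
Hypothesis U_ge0 : forall x, 0 <= U x.
Hypothesis Up : U p = 0.

Let c := chart_at p.
Let y0 := cmap c p.
Let ac : atlas c := chart_at_atlas p.

Lemma center_cimg : cimg c y0. Proof. exact/cmap_img/chart_at_dom. Qed.

Lemma center_cinv : cinv c y0 = p. Proof. exact/cmapK/chart_at_dom. Qed.

Lemma tparam_center0 : tparam c y0 0 = TPoint (0 : tangent p).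
Proof. by apply: TPoint_eq; [exact: center_cinv|exact: linear0]. Qed.

(** A zero of the nonnegative [U] is a minimum, hence critical; at velocity 0 the force then
    vanishes, and the constant curve is a solution. *)
Lemma equilibrium_zero : equilibrium (lagrangian Q U) (TPoint (0 : tangent p)).
Proof.
have [g [gs gsym gQ]] := Q_smooth ac.
have sol : solution g (U \o cinv c) (cimg c) setT (cst y0) (cst 0) (cst 0).
  split => [t _|t _|t _|t _|t i _].
  - exact: center_cimg.
  - exact: is_derive_cst.
  - exact: is_derive_cst.
  - exact: cst_continuous.
  - have umin : \forall y \near y0, (U \o cinv c) y0 <= (U \o cinv c) y.
      by apply: filterS (near_cimg center_cimg) => y _ /=; rewrite center_cinv Up.
    have du := smooth_on_diff (U_smooth ac) center_cimg.
    rewrite /force (derive_eq0_at_min _ du umin).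
    rewrite /bilin big1 ?subr0.
      exact: (is_derive_cst (momentum g y0 0 i) t 1).
    by move=> j _; rewrite big1// => k _; rewrite /cst mxE mulr0 mul0r.
have oT : open (setT : set R) by exact: openT.
exists (cinv c \o cst y0).
  by apply: (motion_of_solution U_smooth ac gs gsym gQ oT _ sol).
by move=> t; rewrite (tangent_lift_solution ac oT sol)//; exact: tparam_center0.
Qed.

(** The neighbourhood tested against stability. It restricts the position alone, since it is the
    position that escapes. *)
Lemma nbhs_base_box rho : 0 < rho ->
  nbhs (TPoint (0 : tangent p))
    [set w : tangent_bundle M | cdom c (tbase w) /\ `|cmap c (tbase w) - y0| < rho].
Proof.
move=> rho0; apply: open_nbhs_nbhs; split; last first.
  by split; [exact: chart_at_dom|rewrite /= subrr normr0].
have : tb_open [set w : tangent_bundle M |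
  cdom c (tbase w) /\ `|cmap c (tbase w) - y0| < rho]; last by [].
move=> d ad.
pose Z := [set y | transition_dom d c y /\ `|(cmap c \o cinv d) y - y0| < rho].
rewrite (_ : [set z | _] = fst @^-1` Z); last first.
  apply/seteqP; split => -[y v] /=; first by move=> [? [? ?]].
  by move=> [[? ?] ?].
apply: open_comp => [z _|]; first exact: cvg_fst.
rewrite openE => y [ty yrho].
have ct : `|(cmap c \o cinv d) z - y0| @[z --> y] --> `|(cmap c \o cinv d) y - y0|.
  apply: (@cvg_norm _ _ _ (nbhs y)); apply: (@cvgB _ _ _ (nbhs y)).
    exact: smooth_on_cont (transition_smooth ad ac) ty.
  exact: (@cvg_cst _ y0 _ (nbhs y)).
exact: filterI (near_transition ty) (cvgr_lt _ ct _ yrho).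
Qed.

(** Supplies admissible initial data: whatever smaller neighbourhood stability offers, it contains
    all small enough vectors at [p]. *)
Lemma nbhs_fibre (W : set (tangent_bundle M)) : nbhs (TPoint (0 : tangent p)) W ->
  exists2 d, 0 < d & forall v : 'rV[R]_n, `|v| < d -> W (tparam c y0 v).
Proof.
rewrite nbhsE => -[B [oB Bw] BW].
have oZ : open [set z : 'rV[R]_n * 'rV[R]_n | cimg c z.1 /\ B (tparam c z.1 z.2)].
  exact: (oB : tb_open B).
have := open_nbhs_nbhs (conj oZ (_ : _ (y0, 0))); rewrite /= tparam_center0.
move=> /(_ (conj center_cimg Bw)) /nbhs_ballP[d /= d0 dP].
exists d => // v vd; apply: BW.
have [] // := dP (y0, v); split; first exact: ballxx.
by rewrite -ball_normE /ball_/= sub0r normrN.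
Qed.

End Main.

Theorem theorem3p1 (R : realType) (n : nat) (M : smooth_manifold R n)
    (Q : forall x : M, tangent x -> R) (U : M -> R) (p : M)
    (Q_smooth : smooth_quadratic_section Q) (Q_pos : positive_definite Q)
    (U_smooth : smooth_function U) (U_ge0 : forall x, 0 <= U x)
    (Up : U p = 0)
    (hV : exists (A : set M) (V : forall x : M, tangent x),
      [/\ open A, A p, locally_lipschitz_field A V,
          weakly_logarithmic U A V & V p != 0]) :
  lyapunov_unstable_equilibrium (lagrangian Q U) (TPoint (0 : tangent p)).
Proof.
split; first exact: equilibrium_zero.
move=> stable.
have [A [V [oA Ap Vlip [P [Pbnd Plog]] Vp]]] := hV.
pose c := chart_at p; pose y0 := cmap c p.
have ac : atlas c := chart_at_atlas p.
have cy0 : cimg c y0 := center_cimg p.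
have icy0 : cinv c y0 = p := center_cinv p.
have [g [gs gsym gQ]] := Q_smooth c ac.
pose D := [set y | cimg c y /\ A (cinv c y)].
pose Y y : 'rV[R]_n := tcoord c (V (cinv c y)).
have Dy0 : D y0 by split => //; rewrite icy0.
(* The Lipschitz bound is local, near the diagonal point [(y0, y0)], and is available for every
   constant above [Mm]. *)
have [Mm [Mreal ML]] := Vlip c ac (y0, y0) (conj Dy0 Dy0).
have nD : \forall y \near y0, D y.
  apply: filterI (near_cimg cy0) _.
  by apply: (cinv_cont cy0); apply: open_nbhs_nbhs; rewrite icy0.
have [r1 /= r10 DP] : exists2 r, 0 < r & forall y, `|y - y0| < r -> D y.
  have /nbhs_ballP[r /= r0 rP] := nD; exists r => // y yr; apply: rP.
  by rewrite -ball_normE /ball_/= distrC.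
have ML1 := ML (Mm + 1) (_ : Mm < Mm + 1); rewrite ltrDl ltr01 in ML1.
have /nbhs_ballP[r2 /= r20 LP] := ML1 isT.
(* Halving puts the closed box inside the open balls on which [D] and the Lipschitz bound hold. *)
pose r := Num.min r1 r2 / 2.
have m0 : 0 < Num.min r1 r2 by rewrite lt_min r10.
have r0 : 0 < r by rewrite divr_gt0.
have rm : r < Num.min r1 r2 by rewrite ltr_pdivrMr// ltr_pMr// ltr1n.
have [rr1 rr2] : r < r1 /\ r < r2 by apply/andP; rewrite -lt_min.
have boxD y : box y0 r y -> D y by move=> yr; apply: DP; exact: le_lt_trans rr1.
have boxO : box y0 r `<=` cimg c by move=> y /boxD[].
have Ylip : exists L, forall x w, box y0 r x -> box y0 r w ->
    `|Y x - Y w| <= L * `|x - w|.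
  exists (Mm + 1) => x w xB wB; apply: (LP (x, w)).
    by split; rewrite -ball_normE /ball_/= distrC; exact: le_lt_trans rr2.
  by split; exact: boxD.
(* The image of the box in [M] is a compact subset of [A], on which [P] is bounded by assumption. *)
have Pb : exists C, forall x, box y0 r x -> `|P (cinv c x)| <= C.
  have cK : compact (cinv c @` box y0 r).
    apply: continuous_compact; last exact: box_compact.
    apply: continuous_in_subspaceT => y /set_mem yB.
    by apply: cinv_cont; exact: boxO.
  have KA : cinv c @` box y0 r `<=` A by move=> _ [y /boxD[_ Ay] <-].
  have /pinfty_ex_gt0[C _ CP] := Pbnd _ cK KA.
  by exists C => x xB; apply: CP; exists x.
have Ylog x : box y0 r x -> 'D_(Y x) (U \o cinv c) x = P (cinv c x) * (U \o cinv c) x.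
  move=> /boxD[cx Ax]; rewrite -(lie_derivative_chart U_smooth ac V cx).
  exact: Plog.
have Yy0 : Y y0 != 0.
  by rewrite /Y icy0 /tcoord transition_id.
have gpos y v : cimg c y -> v != 0 -> 0 < bilin g y v v.
  exact: (bilin_gt0 ac gQ).
have uy0 : (U \o cinv c) y0 = 0 by rewrite /= icy0.
have [rho rho0 escape] := local_escape gs gsym gpos (U_smooth c ac)
  (fun y _ => U_ge0 (cinv c y)) r0 boxO Ylog Ylip Pb uy0 Yy0.
have [W' [_ nW' W'W]] := stable _ (nbhs_base_box p rho0).
have [d d0 W'd] := nbhs_fibre nW'.
have [v0 v0d [J [q [v [a [[oJ iJ J0 q0 vv0] [sol [t [Jt t0 far]]]]]]]]] := escape d d0.
have mot := motion_of_solution U_smooth ac gs gsym gQ oJ iJ sol.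
have := W'W _ _ mot J0 _ t Jt t0.
rewrite !(tangent_lift_solution ac oJ sol)// q0 vv0 => /(_ (W'd v0 v0d)) [_].
have [dom _ _ _ _] := sol.
by rewrite /= (cinvK (dom _ Jt)) ltNge far.
Qed.
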